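(* A real number $\xi$ is extremal with an associated Fibonacci sequence contained in $\mathrm{GL}_2(\mathbb{Z})$ if and only if the sequence of partial quotients of its continued fraction expansion coincides, up to its first terms, with the limit of a Fibonacci sequence of words $(w_i)_{i\ge 1}$ in $(\mathbb{N}\setminus\{0\})^*$ starting with two non-commuting words $w_1$ and $w_2$.
   Context: Let $\gamma=(1+\sqrt5)/2$. A real number $\xi$ is extremal if it is neither rational nor quadratic over $\mathbb{Q}$ and there is $c>0$ such that for every real $X\ge1$ the system $|x_0|\le X$, $|x_0\xi-x_1|\le cX^{-1/\gamma}$, $|x_0\xi^2-x_2|\le cX^{-1/\gamma}$ has a non-zero integer solution. ${\mathcal{P}}$ is the set of primitive (entries with gcd 1) integer $2\times2$ matrices with non-zero determinant, a group under $A*B=(AB)^{\mathrm{red}}$, where $C^{\mathrm{red}}$ is $C$ divided by the positive gcd of its entries. A Fibonacci sequence in a monoid is a sequence with $w_{i+2}=w_{i+1}w_i$ for all $i\ge1$. A Fibonacci sequence $(W_i)$ in ${\mathcal{P}}$ is admissible if there is $N\in{\mathcal{P}}$, neither symmetric nor skew-symmetric, such that with $N_i={}^tN$ ($i$ odd), $N_i=N$ ($i$ even), each $W_iN_i$ is symmetric. Writing $\|A\|$ for the max absolute value of entries, a Fibonacci sequence $(W_i)$ in ${\mathcal{P}}$ is associated to $\xi$ if it is unbounded, admissible, and satisfies, with constants independent of $i$, $\|W_{i+1}\|\asymp\|W_i\|^\gamma$, $\|(\xi,-1)W_i\|\asymp\|W_i\|^{-1}$ and $|\det W_i|\asymp1$.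 For words, $E^*$ is the free monoid on $E$ with concatenation; for a Fibonacci sequence of words $(w_i)$, $w_i$ is a prefix of $w_{i+1}$ for $i\ge2$, and its limit is the (possibly infinite) word having all $w_i$, $i\ge 2$, as prefixes. *)

(* Defs.v *)
From HB Require Import structures.
From mathcomp Require Import all_boot all_order all_algebra.
From mathcomp Require Import all_classical all_reals all_analysis.

Set Implicit Arguments.
Unset Strict Implicit.
Unset Printing Implicit Defensive.

Import Order.TTheory GRing.Theory Num.Theory.
Import numFieldNormedType.Exports.

Local Open Scope ring_scope.

(* All sequences below are indexed by i >= 1; their value at 0 is irrelevant. *)

Definition fibonacci_seq (M : Type) (op : M -> M -> M) (w : nat -> M) : Prop :=
  forall i : nat, (1 <= i)%N -> w i.+2 = op (w i.+1) (w i).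

(* Order of magnitude a_i \asymp b_i over the indices i >= 1. *)
Definition asymp (R : realType) (a b : nat -> R) : Prop :=
  exists c1 c2 : R, [/\ 0 < c1, 0 < c2 &
    forall i : nat, (1 <= i)%N -> c1 * b i <= a i /\ a i <= c2 * b i].

Definition golden (R : realType) : R := (1 + Num.sqrt 5) / 2.

Definition rational (R : realType) (xi : R) : Prop :=
  exists q : rat, xi = ratr q.

Definition quadratic (R : realType) (xi : R) : Prop :=
  exists p : {poly rat},
    [/\ irreducible_poly p, size p = 3%N & root (map_poly ratr p) xi].

Definition extremal (R : realType) (xi : R) : Prop :=
  [/\ ~ rational xi, ~ quadratic xi &
    exists2 c : R, 0 < c & forall X : R, 1 <= X ->
      exists x0 x1 x2 : int,
        [/\ (x0, x1, x2) <> (0, 0, 0),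
            `|x0%:~R| <= X,
            `|x0%:~R * xi - x1%:~R| <= c * X `^ (- (golden R)^-1) &
            `|x0%:~R * xi ^+ 2 - x2%:~R| <= c * X `^ (- (golden R)^-1)]].

(* [gcdz] is nonnegative, so [content C] is the nonnegative gcd of the entries. *)
Definition content (C : 'M[int]_2) : int :=
  \big[gcdz/0]_(i < 2) \big[gcdz/0]_(j < 2) C i j.

Definition in_P (A : 'M[int]_2) : Prop := content A = 1 /\ \det A <> 0.

Definition red (C : 'M[int]_2) : 'M[int]_2 :=
  map_mx (fun x : int => (x %/ content C)%Z) C.

Definition star (A B : 'M[int]_2) : 'M[int]_2 := red (A *m B).

Definition fibonacci_in_P (W : nat -> 'M[int]_2) : Prop :=
  (forall i : nat, (1 <= i)%N -> in_P (W i)) /\ fibonacci_seq star W.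

Definition symmetric_mx (A : 'M[int]_2) : Prop := A^T = A.
Definition skew_symmetric_mx (A : 'M[int]_2) : Prop := A^T = - A.

Definition admissible (W : nat -> 'M[int]_2) : Prop :=
  exists N : 'M[int]_2,
    [/\ in_P N, ~ symmetric_mx N, ~ skew_symmetric_mx N &
      forall i : nat, (1 <= i)%N ->
        symmetric_mx (W i *m (if odd i then N^T else N))].

(* [mx_norm] is the maximum of the absolute values of the entries. *)
Definition normZ (R : realType) (A : 'M[int]_2) : R :=
  mx_norm (map_mx intr A : 'M[R]_2).

(* The row vector (xi, -1). *)
Definition xi_row (R : realType) (xi : R) : 'rV[R]_2 :=
  \row_(j < 2) (if j == 0 then xi else - 1).

Definition associated (R : realType) (xi : R) (W : nat -> 'M[int]_2) : Prop :=
  [/\ forall B : R, exists2 i : nat, (1 <= i)%N & B < normZ R (W i),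
      admissible W,
      asymp (fun i => normZ R (W i.+1)) (fun i => normZ R (W i) `^ golden R),
      asymp (fun i => mx_norm (xi_row xi *m map_mx intr (W i)))
            (fun i => (normZ R (W i))^-1) &
      asymp (fun i => `|(\det (W i))%:~R| : R) (fun=> 1)].

(* Finite words are elements of [seq E], the free monoid on E under [++].      *)
(* A possibly infinite word is a map [nat -> option E], [None] meaning that    *)
(* the word has no letter at that position.  The limit is the shortest word    *)
(* having all w_i with i >= 2 as prefixes.                                     *)
Definition limit_word (E : Type) (w : nat -> seq E) (u : nat -> option E) :
    Prop :=
  forall (n : nat) (a : E),
    u n = Some a <-> exists2 i : nat, (2 <= i)%N & onth (w i) n = Some a.

Definition posnat : Type := {n : nat | (0 < n)%N}.

(* Regular continued fraction expansion, with [None] past the end of the       *)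
(* (finite) expansion of a rational number.                                    *)
Fixpoint complete_quotient (R : realType) (xi : R) (n : nat) : option R :=
  if n is m.+1 then
    if complete_quotient xi m is Some x then
      let f := x - (Num.floor x)%:~R in
      if f == 0 then None else Some f^-1
    else None
  else Some xi.

Definition partial_quotient (R : realType) (xi : R) (n : nat) : option int :=
  omap Num.floor (complete_quotient xi n).

(* The expansion of xi, deprived of its first k terms, is the word u. *)
Definition cf_coincides_up_to_first_terms (R : realType) (xi : R)
    (u : nat -> option posnat) : Prop :=
  exists k : nat, forall n : nat,
    partial_quotient xi (k + n) = omap (fun a : posnat => (val a)%:Z) (u n).

(* Main.v *)
(** Write [[0 1; 1 a]] for the matrix of a letter [a], and [Psi w] for the product
    along a word [w]; the convergents of a real number are the columns of such
    products.

    From words to matrices: if the expansion of [xi] is, after [k] terms, the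
    limit of the words [w_i], let [A] be the [k]-th convergent matrix of [xi].
    Then [W_i = A (Psi w_i) A^-1] is a Fibonacci sequence in GL_2(Z) which
    [(xi, -1)] nearly annihilates.  The symmetry of the [W_i N_i] propagates from
    [i] and [i + 1] to [i + 3], so [N] has to satisfy three linear equations only;
    [(W_1 W_2 - W_2 W_1) W_2 W_1 [0 1; -1 0]] is a solution, and the commutator is
    invertible because the characteristic polynomial of [Psi w] has no rational
    root.  The matrices [W_i N_i] then show that [xi] is extremal; [xi] has degree
    at least 3 since an integer quadratic relation would make three consecutive
    ones linearly dependent.

    From matrices to words: the columns of [W_i] approach the direction of
    [(1, xi)] and, as [W_i N_i] is symmetric, its rows approach one of two fixed
    directions.  Conjugating by a convergent matrix of [xi] of large index brings
    [W_i], for large [i], to a matrix with entries of constant sign that increase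
    along rows and columns, that is, to some [+- Psi w_i].  The words [w_i] form a
    Fibonacci sequence because [Psi] is injective. *)
Require Import Defs.
From mathcomp Require Import all_boot all_order all_algebra.
From mathcomp Require Import all_classical all_reals all_analysis.
From mathcomp Require Import ring lra zify.
Set Implicit Arguments.
Unset Strict Implicit.
Unset Printing Implicit Defensive.
Import Order.TTheory GRing.Theory Num.Theory.
Local Open Scope ring_scope.

(** * Matrices of order 2 *)

Lemma ord2P (i : 'I_2) : i = 0 \/ i = 1.
Proof. by case: i => [[|[|]]] // ?; [left | right]; apply: val_inj. Qed.

Lemma matrix2P (T : Type) (A B : 'M[T]_2) :
  A 0 0 = B 0 0 -> A 0 1 = B 0 1 -> A 1 0 = B 1 0 -> A 1 1 = B 1 1 -> A = B.
Proof. by move=> *; apply/matrixP => i j; case: (ord2P i) (ord2P j) => -> [] ->. Qed.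

Lemma mulmx2E (S : comNzRingType) m n (A : 'M[S]_(m, 2)) (B : 'M[S]_(2, n)) i j :
  (A *m B) i j = A i 0 * B 0 j + A i 1 * B 1 j.
Proof. by rewrite mxE big_ord_recl big_ord1; congr (_ + _ * B _ _); f_equal; apply: val_inj. Qed.

Lemma det2E (S : comNzRingType) (A : 'M[S]_2) :
  \det A = A 0 0 * A 1 1 - A 0 1 * A 1 0.
Proof.
rewrite (expand_det_row _ 0) big_ord_recl big_ord1 /cofactor !det_mx11 !mxE /=.
rewrite expr0 expr1 mul1r mulN1r mulrN.
by congr (A _ _ * A _ _ - A _ _ * A _ _); apply: val_inj.
Qed.

Definition mx2 (S : Type) (a b c d : S) : 'M[S]_2 :=
  \matrix_(i, j) if i == 0 then (if j == 0 then a else b)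
                 else (if j == 0 then c else d).

Lemma mx2_eta (S : Type) (A : 'M[S]_2) : A = mx2 (A 0 0) (A 0 1) (A 1 0) (A 1 1).
Proof. by apply: matrix2P; rewrite mxE. Qed.

Lemma mul_mx2 (S : comNzRingType) (a b c d a' b' c' d' : S) :
  mx2 a b c d *m mx2 a' b' c' d' =
  mx2 (a * a' + b * c') (a * b' + b * d') (c * a' + d * c') (c * b' + d * d').
Proof. by apply: matrix2P; rewrite mulmx2E !mxE. Qed.

Lemma add_mx2 (S : zmodType) (a b c d a' b' c' d' : S) :
  mx2 a b c d + mx2 a' b' c' d' = mx2 (a + a') (b + b') (c + c') (d + d').
Proof. by apply: matrix2P; rewrite !mxE. Qed.

Lemma opp_mx2 (S : zmodType) (a b c d : S) : - mx2 a b c d = mx2 (- a) (- b) (- c) (- d).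
Proof. by apply: matrix2P; rewrite !mxE. Qed.

Lemma tr_mx2 (S : Type) (a b c d : S) : (mx2 a b c d)^T = mx2 a c b d.
Proof. by apply: matrix2P; rewrite !mxE. Qed.

Lemma det_mx2 (S : comNzRingType) (a b c d : S) : \det (mx2 a b c d) = a * d - b * c.
Proof. by rewrite det2E !mxE. Qed.

Lemma mx2_inj (S : Type) (a b c d a' b' c' d' : S) :
  mx2 a b c d = mx2 a' b' c' d' -> [/\ a = a', b = b', c = c' & d = d'].
Proof.
move=> e; have h i j := congr1 (fun M : 'M[S]_2 => M i j) e.
by have := h 0 0; have := h 0 1; have := h 1 0; have := h 1 1; rewrite !mxE.
Qed.

Definition mx2E := (mul_mx2, add_mx2, opp_mx2, tr_mx2, det_mx2).

Lemma symmetric_mx2P (a b c d : int) : symmetric_mx (mx2 a b c d) <-> b = c.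
Proof. by rewrite /symmetric_mx tr_mx2; split=> [e|->] //; case: (mx2_inj e). Qed.

Lemma unimodularP (A : 'M[int]_2) :
  reflect (\det A = 1 \/ \det A = -1) (A \in unitmx).
Proof.
rewrite unitmxE; apply: (iffP idP) => [|[->|->]] //.
by rewrite qualifE => /orP[] /eqP ->; [left|right].
Qed.

(** * Contents and primitive matrices *)

Lemma dvdz_contentP (d : int) (A : 'M[int]_2) :
  reflect (forall i j, (d %| A i j)%Z) (d %| Defs.content A)%Z.
Proof.
rewrite /Defs.content !big_ord_recl !big_ord0 /= !gcdz0.
rewrite !(dvdz_gcd, dvdzE, absz_nat, dvdn_gcd) /=.
apply: (iffP idP) => [/andP[/andP[h1 h2] /andP[h3 h4]] i j|h].
  by case: (ord2P i) (ord2P j) => -> [] ->;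
    [move: h1 | move: h2 | move: h3 | move: h4];
    rewrite dvdzE; congr (_ %| `|A _ _|)%N; apply: val_inj.
by do 2 (apply/andP; split); rewrite -?dvdzE.
Qed.

Lemma content_ge0 (A : 'M[int]_2) : 0 <= Defs.content A.
Proof. by rewrite /Defs.content !big_ord_recl !big_ord0. Qed.

(** The content divides the determinant, which is a unit. *)
Lemma content_unimodular (A : 'M[int]_2) : A \in unitmx -> Defs.content A = 1.
Proof.
move=> /unimodularP uA.
have /dvdz_contentP dA := dvdzz (Defs.content A).
have : (Defs.content A %| \det A)%Z by rewrite det2E rpredB // dvdz_mull.
have := content_ge0 A.
by case: uA => ->; case: (Defs.content A) => // n _; rewrite dvdzE /= dvdn1 => /eqP ->.
Qed.

Lemma unimodular_in_P (A : 'M[int]_2) : A \in unitmx -> in_P A.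
Proof.
move=> uA; split; first exact: content_unimodular.
by case/unimodularP: uA => ->.
Qed.

Lemma red_primitive (A : 'M[int]_2) : Defs.content A = 1 -> red A = A.
Proof. by move=> cA; apply/matrixP => i j; rewrite mxE cA divz1. Qed.

(** Products inside GL_2(Z) are already primitive, so everything below can work with the ordinary
    product. *)
Lemma star_unimodular (A B : 'M[int]_2) :
  A \in unitmx -> B \in unitmx -> star A B = A *m B.
Proof.
by move=> uA uB; rewrite /star red_primitive // content_unimodular // unitmx_mul uA.
Qed.

Lemma content_red (A : 'M[int]_2) : \det A <> 0 ->
  [/\ Defs.content A != 0, A = Defs.content A *: red A & Defs.content (red A) = 1].
Proof.
move=> dA; set c := Defs.content A.
have /dvdz_contentP dvA := dvdzz c.
have eA : A = c *: red A by apply/matrixP => i j; rewrite !mxE mulrC divzK.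
have c0 : c != 0.
  by apply/eqP => c0; apply: dA; rewrite eA c0 scale0r det0.
split=> //.
have /dvdz_contentP dvr := dvdzz (Defs.content (red A)).
have : (c * Defs.content (red A) %| Defs.content A)%Z.
  by apply/dvdz_contentP => i j; rewrite [A i j](congr1 (fun M : 'M[int]_2 => M i j) eA) mxE;
    apply: dvdz_mul.
rewrite -/c -[X in (_ %| X)%Z]mulr1 dvdz_mul2l //=.
have := content_ge0 (red A).
by case: (Defs.content (red A)) => // n _; rewrite dvdzE /= dvdn1 => /eqP ->.
Qed.

(** * Maximum norms of matrices *)

Lemma mx_norm_ge (R : realType) m n (A : 'M[R]_(m, n)) i j : `|A i j| <= mx_norm A.
Proof. by rewrite mx_normrE; exact: (le_bigmax 0 (fun ij => `|A ij.1 ij.2|) (i, j)). Qed.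

Lemma mx_norm_le (R : realType) m n (A : 'M[R]_(m, n)) (c : R) :
  0 <= c -> (forall i j, `|A i j| <= c) -> mx_norm A <= c.
Proof. by move=> c0 h; rewrite mx_normrE; apply: bigmax_le => // -[i j] _; apply: h. Qed.

Lemma mx_norm_ge0 (R : realType) m n (A : 'M[R]_(m, n)) : 0 <= mx_norm A.
Proof. by rewrite mx_normrE; apply: le_trans (bigmax_ge_id _ _ _ _). Qed.

Lemma mx_normM (R : realType) m n (A : 'M[R]_(m, 2)) (B : 'M[R]_(2, n)) :
  mx_norm (A *m B) <= 2 * mx_norm A * mx_norm B.
Proof.
have [A0 B0] := (mx_norm_ge0 A, mx_norm_ge0 B).
apply: mx_norm_le => [|i j]; first by rewrite !mulr_ge0.
rewrite mulmx2E; apply: le_trans (ler_normD _ _) _; rewrite !normrM.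
have -> : 2 * mx_norm A * mx_norm B = mx_norm A * mx_norm B + mx_norm A * mx_norm B by ring.
by apply: lerD; apply: ler_pM => //; apply: mx_norm_ge.
Qed.

Lemma normZ_ge0 (R : realType) (A : 'M[int]_2) : 0 <= normZ R A.
Proof. exact: mx_norm_ge0. Qed.

Lemma normZ_ge (R : realType) (A : 'M[int]_2) i j : `|(A i j)%:~R : R| <= normZ R A.
Proof. by have := mx_norm_ge (map_mx intr A : 'M[R]_2) i j; rewrite mxE. Qed.

Lemma normZ_le (R : realType) (A : 'M[int]_2) (c : R) :
  0 <= c -> (forall i j, `|(A i j)%:~R : R| <= c) -> normZ R A <= c.
Proof. by move=> c0 h; apply: mx_norm_le => // i j; rewrite mxE. Qed.

Lemma normZM (R : realType) (A B : 'M[int]_2) :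
  normZ R (A *m B) <= 2 * normZ R A * normZ R B.
Proof. by rewrite /normZ map_mxM /=; apply: mx_normM. Qed.

Lemma normZ_ge1 (R : realType) (A : 'M[int]_2) : A <> 0 -> 1 <= normZ R A.
Proof.
move=> A0.
have [i [j nz]] : exists i j, A i j != 0.
  apply: contrapT => h; apply: A0; apply/matrixP => i j; rewrite mxE.
  by apply/eqP; apply: contrapT => /negP nz; apply: h; exists i, j.
apply: le_trans (normZ_ge R A i j).
by rewrite -intr_norm ler1z; move: nz; case: (A i j) => [[|]|] //.
Qed.

Lemma normZ_unimodular_ge1 (R : realType) (A : 'M[int]_2) : A \in unitmx -> 1 <= normZ R A.
Proof.
by move=> /unimodularP uA; apply: normZ_ge1 => A0; move: uA; rewrite A0 det0 => -[].
Qed.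

(** The inverse is, up to sign, the adjugate, whose entries are those of [A] permuted and up to
    sign. *)
Lemma normZ_invmx (R : realType) (A : 'M[int]_2) : A \in unitmx -> normZ R (invmx A) = normZ R A.
Proof.
move=> uA; rewrite /invmx uA.
have -> : (\det A)^-1 *: \adj A = mx2 (\det A * A 1 1) (- (\det A * A 0 1))
    (- (\det A * A 1 0)) (\det A * A 0 0).
  have -> : (\det A)^-1 = \det A by case/unimodularP: uA => ->.
  by apply: matrix2P; rewrite !mxE /cofactor !det_mx11 !mxE /= ?expr0 ?expr1
    ?mul1r ?mulN1r ?mulrN ?addn0 /=;
    do ?congr (- _); congr (_ * A _ _); apply: val_inj.
have dn (x : int) : `|(\det A * x)%:~R : R| = `|x%:~R : R|.
  by rewrite intrM normrM; case/unimodularP: uA => ->; rewrite ?intrN ?normrN normr1 mul1r.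
by apply/eqP; rewrite eq_le; apply/andP; split; apply: normZ_le => [|i j];
  rewrite ?normZ_ge0 //; [rewrite mxE | have := fun i j => normZ_ge R (mx2 (\det A * A 1 1) (-
    (\det A * A 0 1))
    (- (\det A * A 1 0)) (\det A * A 0 0)) i j];
  case: (ord2P i) (ord2P j) => -> [] -> //=; rewrite ?intrN ?normrN ?dn ?normZ_ge //;
  move=> h; [have := h 1 1|have := h 0 1|have := h 1 0|have := h 0 0];
  rewrite mxE /= ?intrN ?normrN dn.
Qed.

(** * Twisting matrices *)

Definition twist (N : 'M[int]_2) (i : nat) : 'M[int]_2 := if odd i then N^T else N.

Lemma twistS N i : twist N i.+1 = (twist N i)^T.
Proof. by rewrite /twist /=; case: (odd i); rewrite //= trmxK. Qed.

(** Since [W_{i+3} = W_{i+1} W_i W_{i+1}] and [W_{i+1} N_{i+1}] is symmetric, [W_{i+3} N_{i+3}] is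
    the congruence transform of [W_i N_i] by [W_{i+1}]. *)
Lemma symmetric_twist_fibonacci (W : nat -> 'M[int]_2) (N : 'M[int]_2) :
  fibonacci_seq mulmx W ->
  symmetric_mx (W 1%N *m N^T) -> symmetric_mx (W 2%N *m N) ->
  symmetric_mx (W 2%N *m W 1%N *m N^T) ->
  forall i, (1 <= i)%N -> symmetric_mx (W i *m twist N i).
Proof.
move=> fW s1 s2 s3.
have s i : [/\ symmetric_mx (W i.+1 *m twist N i.+1),
  symmetric_mx (W i.+2 *m twist N i.+2) & symmetric_mx (W i.+3 *m twist N i.+3)].
  elim: i => [|i [h1 h2 h3]]; first by split=> //; rewrite fW.
  split=> //.
  have -> : W i.+4 *m twist N i.+4 =
      W i.+2 *m (W i.+1 *m twist N i.+1) *m (W i.+2)^T.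
    have -> : twist N i.+4 = twist N i.+2 by rewrite !(twistS _ i.+2, twistS _ i.+3) trmxK.
    rewrite fW // fW // -!mulmxA -h2 trmx_mul.
    by rewrite [in twist N i.+2]twistS trmxK !mulmxA.
  by rewrite /symmetric_mx trmx_mul trmxK trmx_mul h1 mulmxA.
by case=> // i _; have [] := s i.
Qed.

(* The product with [0 1; -1 0] turns "symmetric" into "of trace 0"; this is the
   solution, up to scaling, of the three linear conditions on N. *)
Definition twisting_mx (A B : 'M[int]_2) : 'M[int]_2 :=
  (A *m B - B *m A) *m B *m A *m mx2 0 1 (-1) 0.

(** Write [C = AB - BA] and [J = [0 1; -1 0]]. As [J M^T J^-1] is the adjugate of [M], the three
    conditions amount, for invertible [A] and [B], to the vanishing of the traces of [C B],
    [B C B A] and [C]; each is a difference of traces of two words equal up to a cyclic shift. *)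
Lemma twisting_mx_symmetric (A B : 'M[int]_2) (N := twisting_mx A B) :
  [/\ symmetric_mx (A *m N^T), symmetric_mx (B *m N) & symmetric_mx (B *m A *m N^T)].
Proof.
by rewrite /N /twisting_mx [A]mx2_eta [B]mx2_eta !mx2E; split; apply/symmetric_mx2P; ring.
Qed.

Lemma symmetric_mxZ (c : int) (A : 'M[int]_2) : c != 0 -> symmetric_mx (c *: A) <->
  symmetric_mx A.
Proof.
move=> c0; rewrite /symmetric_mx linearZ /=; split=> [|->] //.
by move/(scalemx_inj c0).
Qed.

(** The determinant condition makes [N] invertible and non-symmetric; together with the trace
    condition it also excludes skew symmetry. *)
Lemma admissible_of_commutator (W : nat -> 'M[int]_2) :
  fibonacci_seq mulmx W ->
  (forall i, (1 <= i)%N -> W i \in unitmx) ->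
  \det (W 1%N *m W 2%N - W 2%N *m W 1%N) <> 0 ->
  \tr (W 2%N *m W 1%N) <> 0 -> admissible W.
Proof.
move=> fW uW dC tBA; set A := W 1%N; set B := W 2%N; set N := twisting_mx A B.
have dN : \det N = \det (A *m B - B *m A) * (\det B * \det A).
  by rewrite /N /twisting_mx !det_mulmx det_mx2; ring.
have dN0 : \det N <> 0.
  move/eqP; rewrite dN !mulf_eq0 => /or3P[/eqP //||];
  by [case/unimodularP: (uW 2%N isT) => -> | case/unimodularP: (uW 1%N isT) => ->].
have [c0 eN cN] := content_red dN0.
set c := Defs.content N in c0 eN; set N' := red N in eN cN.
(* [N] is symmetric exactly when [(AB - BA)BA] has trace 0, and this trace equals the determinant of
   [AB - BA]. *)
have symN : ~ symmetric_mx N.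
  move=> sN; apply: dC; move: sN; rewrite /N /twisting_mx -/A -/B [A]mx2_eta [B]mx2_eta !mx2E.
  by move/symmetric_mx2P => h; lia.
(* With [C] the commutator and [P = BA], skew symmetry of [N] says that [C P = [u v; w t]] is a
   scalar matrix. *)
have skewN : ~ skew_symmetric_mx N.
  have [x [y [z eC]]] : exists x y z, A *m B - B *m A = mx2 x y z (- x).
    rewrite [A]mx2_eta [B]mx2_eta !mx2E; do 3 eexists.
    by congr mx2; ring.
  move: dN0 tBA; rewrite -/A -/B /N /twisting_mx -(mulmxA _ B A) eC.
  rewrite /mxtrace big_ord_recl big_ord1 (_ : lift ord0 ord0 = 1); last exact: val_inj.
  rewrite (_ : ord0 = 0) //; move: (B *m A) => P.
  rewrite /skew_symmetric_mx [P]mx2_eta !mx2E !mxE /=.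
  move: (P 0 0) (P 0 1) (P 1 0) (P 1 1) => p q r s.
  set u := x * p + y * r; set v := x * q + y * s.
  set w := z * p + - x * r; set t := z * q + - x * s.
  (* This expresses that [C P] times the adjugate of [P] has trace [det P] times [tr C], hence 0.
     For a scalar [C P] it reads [u tr P = 0]. *)
  have id : u * s + t * p = r * v + q * w by rewrite /u /v /w /t; ring.
  move: u v w t id => u v w t id dN0 tP e; have [e1 e2 e3 e4] := mx2_inj e.
  have [v0 w0 ut] : [/\ v = 0, w = 0 & u = t] by split; lia.
  have : u * (p + s) = 0 by move: id; rewrite v0 w0 -ut => id; lia.
  by move/eqP; rewrite mulf_eq0 => /orP[/eqP u0|/eqP //]; apply: dN0; rewrite v0 u0; ring.
(* Dividing by the content makes [N] primitive and preserves the linear conditions. *)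
exists N'; split=> //.
- by split=> // dN'; apply: dN0; rewrite eN detZ dN' mulr0.
- by rewrite -(symmetric_mxZ _ c0) -eN.
- by move=> sN'; apply: skewN; rewrite /skew_symmetric_mx eN linearZ /= sN' scalerN.
- move=> i i1; rewrite -/(twist N' i) -(symmetric_mxZ _ c0) scalemxAr.
  have -> : c *: twist N' i = twist N i by rewrite eN /twist; case: odd; rewrite ?linearZ.
  have [s1 s2 s3] := twisting_mx_symmetric A B.
  exact: symmetric_twist_fibonacci.
Qed.

(** Transposing [BAN = ABN] gives [ABN = A N B^T]; cancelling [A] yields [BN = N B^T], which is
    [B N^T] by symmetry. This will show that the words obtained from a Fibonacci sequence of
    matrices do not commute. *)
Lemma commuting_twist_symmetric (A B N : 'M[int]_2) :
  A \in unitmx -> B \in unitmx -> A *m B = B *m A ->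
  symmetric_mx (A *m N) -> symmetric_mx (B *m N^T) -> symmetric_mx (B *m A *m N) ->
  symmetric_mx N.
Proof.
move=> uA uB AB sA sB sBA.
have e1 : A *m (B *m N) = A *m (N *m B^T).
  by rewrite mulmxA AB -sBA -mulmxA trmx_mul sA mulmxA.
have e2 : B *m N = N *m B^T by rewrite -[LHS](mulKmx uA) e1 mulKmx.
have e3 : B *m N = B *m N^T by rewrite e2 -sB trmx_mul trmxK.
by rewrite /symmetric_mx -[LHS](mulKmx uB) -e3 mulKmx.
Qed.

(* The determinant of three consecutive symmetric matrices Z, W N, W Z, seen as
   points of Z^3, is  det Z * det W * (N 0 1 - N 1 0) up to sign. *)
Lemma consecutive_independent (a b c : int) (Z W N : 'M[int]_2)
    (L := fun M : 'M[int]_2 => c * M 0 0 + b * M 0 1 + a * M 1 1) :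
  \det Z <> 0 -> \det W <> 0 -> ~ symmetric_mx N ->
  symmetric_mx Z -> symmetric_mx (W *m N) -> symmetric_mx (W *m Z) ->
  L Z = 0 -> L (W *m N) = 0 -> L (W *m Z) = 0 -> [/\ a = 0, b = 0 & c = 0].
Proof.
rewrite /L [Z]mx2_eta [W]mx2_eta [N]mx2_eta !mx2E ![mx2 _ _ _ _ _ _]mxE /=.
move: (Z 0 0) (Z 0 1) (Z 1 0) (Z 1 1) (W 0 0) (W 0 1) (W 1 0) (W 1 1).
move: (N 0 0) (N 0 1) (N 1 0) (N 1 1) => p q r s x y y' w e f g h.
move=> dZ dW sN /symmetric_mx2P sZ /symmetric_mx2P sWN /symmetric_mx2P sWZ.
move: sZ sWZ dZ => <- {y'} sWZ dZ.
set X0 := e * p + f * r; set X1 := e * q + f * s; set X2 := g * q + h * s.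
move=> L1 L2 L3.
have nz : (x * w - y * y) * ((e * h - f * g) * (q - r)) != 0.
  rewrite !mulf_neq0 //; try exact/eqP.
  by rewrite subr_eq0; apply/eqP => qr; apply: sN; rewrite qr; apply/symmetric_mx2P.
have k0 (k : int) : k * ((x * w - y * y) * ((e * h - f * g) * (q - r))) = 0 -> k = 0.
  by move/eqP; rewrite mulf_eq0 (negPf nz) orbF => /eqP.
move: L3; set v0 := e * x + f * y; set v1 := e * y + f * w; set v2 := g * y + h * w => L3.
(* [c1], [c2] and [c3] compute the cross product of the points of [Z] and [W Z]; [D] is then its
   scalar product with the point of [W N]. *)
have c1 : y * v2 - w * v1 = - g * (x * w - y * y) by rewrite /v1 sWZ /v2; ring.
have c2 : w * v0 - x * v2 = (e - h) * (x * w - y * y).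
  transitivity ((e - h) * (x * w - y * y) - y * (g * x + h * y - (e * y + f * w))).
    by rewrite /v0 /v2; ring.
  by rewrite sWZ subrr mulr0 subr0.
have c3 : x * v1 - y * v0 = f * (x * w - y * y) by rewrite /v0 /v1; ring.
have D0 : - g * X0 + (e - h) * X1 + f * X2 = - ((e * h - f * g) * (q - r)).
  transitivity (- ((e * h - f * g) * (q - r)) + e * (e * q + f * s - (g * p + h * r))).
    by rewrite /X0 /X1 /X2; ring.
  by rewrite sWN subrr mulr0 addr0.
have D : (y * v2 - w * v1) * X0 + (w * v0 - x * v2) * X1 + (x * v1 - y * v0) * X2 =
    - ((x * w - y * y) * ((e * h - f * g) * (q - r))).
  rewrite c1 c2 c3; transitivity ((x * w - y * y) * (- g * X0 + (e - h) * X1 + f * X2));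
    first by ring.
  by rewrite D0 mulrN.
(* Cramer's rule: each coefficient of [L] times the determinant is a combination of the three
   vanishing values of [L]. *)
split; apply: k0; apply: oppr_inj; rewrite -[LHS]mulrN -D oppr0.
- transitivity ((c * x + b * y + a * w) * (v0 * X1 - v1 * X0)
    + (c * v0 + b * v1 + a * v2) * (X0 * y - X1 * x)
    + (c * X0 + b * X1 + a * X2) * (x * v1 - y * v0)); first by ring.
  by rewrite L1 L2 L3 !mul0r !addr0.
- transitivity ((c * x + b * y + a * w) * (v2 * X0 - v0 * X2)
    + (c * v0 + b * v1 + a * v2) * (X2 * x - X0 * w)
    + (c * X0 + b * X1 + a * X2) * (w * v0 - x * v2)); first by ring.
  by rewrite L1 L2 L3 !mul0r !addr0.
- transitivity ((c * x + b * y + a * w) * (v1 * X2 - v2 * X1)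
    + (c * v0 + b * v1 + a * v2) * (X1 * w - X2 * y)
    + (c * X0 + b * X1 + a * X2) * (y * v2 - w * v1)); first by ring.
  by rewrite L1 L2 L3 !mul0r !addr0.
Qed.

(** * Commutators of unimodular matrices *)

(** The number lies strictly between [(t-1)^2] and [t^2] if [d = 1], and strictly between [t^2] and
    [(t+1)^2] if [d = -1], except for [t = 1], where it is 5. *)
Lemma nonsquare_discriminant (t d k : int) :
  (d = 1 /\ 3 <= t) \/ (d = -1 /\ 1 <= t) -> t ^+ 2 - 4 * d <> k ^+ 2.
Proof.
wlog k0 : k / 0 <= k => [h H|].
  case: (leP 0 k) => [k0|kn]; first exact: (h k k0 H).
  by rewrite -(sqrrN k); apply: h => //; rewrite oppr_ge0 ltW.
case=> -[-> t0]; rewrite !expr2 => e.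
  have kt : k <= t - 1 by nia.
  have := ler_pM k0 k0 kt kt; nia.
have tk : t + 1 <= k by nia.
have t1 : 0 <= t + 1 by lia.
have := ler_pM t1 t1 tk tk => h.
have [t2|t2] : t = 1 \/ 2 <= t by lia.
  by rewrite t2 in e; have [|[|]] : k <= 1 \/ (k = 2) \/ (3 <= k) by [lia]; nia.
nia.
Qed.

Lemma sqr_dvd_nonsquare (D s y : int) : (forall k, D <> k ^+ 2) -> s ^+ 2 = D * y ^+ 2 -> y = 0.
Proof.
move=> nD e; apply/eqP/contraT => y0.
have : (y ^+ 2 %| s ^+ 2)%Z by rewrite e dvdz_mull.
rewrite dvdz_pexp2r // => /dvdzP[k sk].
case: (nD k); apply: (mulIf (expf_neq0 2 y0)).
by rewrite -e sk exprMn.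
Qed.

(* A singular commutator is nilpotent, which forces the discriminant of the
   characteristic polynomial of A to be a square. *)
Lemma det_commutator_neq0 (A B : 'M[int]_2) :
  (\det A = 1 /\ 3 <= A 0 0 + A 1 1) \/ (\det A = -1 /\ 1 <= A 0 0 + A 1 1) ->
  A *m B <> B *m A -> \det (A *m B - B *m A) <> 0.
Proof.
move=> hA; have nD k := nonsquare_discriminant (k := k) hA.
move=> nAB dC; apply: nAB; apply/eqP; rewrite -subr_eq0; apply/eqP; move: dC nD {hA}.
rewrite [A]mx2_eta [B]mx2_eta !mx2E !mxE /=.
move: (A 0 0) (A 0 1) (A 1 0) (A 1 1) (B 0 0) (B 0 1) (B 1 0) (B 1 1).
move=> a b c d e f g h.
set x := a * e + b * g - (e * a + f * c); set y := a * f + b * h - (e * b + f * d).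
set z := c * e + d * g - (g * a + h * c); set x' := c * f + d * h - _.
have -> : x' = - x by rewrite /x /x'; ring.
(* The product of [A] and the commutator has trace 0. *)
have : x * (a - d) + y * c + z * b = 0 by rewrite /x /y /z; ring.
move: x y z => x y z tr dC nD.
have yz : y * z = - x ^+ 2 by lia.
(* Eliminating [z] between the trace relation and [y z = - x^2] gives [(2bx - (a-d)y)^2 = D y^2],
   where [D] is the discriminant; [z0] is the transposed argument. *)
have y0 : y = 0.
  apply: (sqr_dvd_nonsquare (s := 2 * b * x - (a - d) * y) nD).
  apply/eqP; rewrite -subr_eq0; apply/eqP.
  transitivity (- (4 * b) * y * (x * (a - d) + y * c + z * b) + 4 * b ^+ 2 * (y * z + x ^+ 2)).
    ring.
  by rewrite tr yz; ring.
have z0 : z = 0.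
  apply: (sqr_dvd_nonsquare (s := 2 * c * x - (a - d) * z) nD).
  apply/eqP; rewrite -subr_eq0; apply/eqP.
  transitivity (- (4 * c) * z * (x * (a - d) + y * c + z * b) + 4 * c ^+ 2 * (y * z + x ^+ 2)).
    ring.
  by rewrite tr yz; ring.
have x0 : x = 0 by nia.
by rewrite x0 y0 z0 oppr0; apply: matrix2P; rewrite !mxE.
Qed.

(** * Growth of Fibonacci sequences *)

Section Golden.
Variable R : realType.
Local Notation g := (golden R).

Lemma golden_sqr : g * g = g + 1.
Proof.
have h : Num.sqrt (5 : R) ^+ 2 = 5 by rewrite sqr_sqrtr.
rewrite /golden; move: (Num.sqrt 5) h => s; rewrite expr2 => h.
transitivity ((1 + 2 * s + s * s) / 4); first by field.
by rewrite h; field.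
Qed.

Lemma golden_gt1 : 1 < g.
Proof.
have : 1 < Num.sqrt (5 : R) by rewrite -[ltLHS]sqrtr1 ltr_sqrt ?ltr1n.
by rewrite /golden => h; lra.
Qed.

Lemma golden_lt2 : g < 2.
Proof. have := golden_sqr; have := golden_gt1; move: g => x; nra. Qed.

Lemma golden_inv : g^-1 = g - 1.
Proof.
have g0 : g != 0 by rewrite gt_eqF // (lt_trans ltr01 golden_gt1).
by apply: (mulfI g0); rewrite divff // mulrBr golden_sqr; ring.
Qed.

(** The defect [y_i = ln X_{i+1} - g ln X_i] satisfies [y_{i+1} = - (g-1) y_i] up to an error of at
    most [ln K], because [g^2 = g + 1]. As [g - 1 < 1], it stays bounded. *)
Lemma fibonacci_growth (X : nat -> R) (K : R) : 1 <= K ->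
  (forall i, (1 <= i)%N -> 0 < X i) ->
  (forall i, (1 <= i)%N -> X i.+1 * X i <= K * X i.+2) ->
  (forall i, (1 <= i)%N -> X i.+2 <= K * (X i.+1 * X i)) ->
  asymp (fun i => X i.+1) (fun i => X i `^ g).
Proof.
move=> K1 X0 lo up.
have K0 : 0 < K by apply: lt_le_trans K1.
have [g2 g1 g3] := And3 golden_sqr golden_gt1 golden_lt2.
pose y i := ln (X i.+1) - g * ln (X i).
pose M := `|y 1%N| + ln K / (2 - g).
have lnK0 : 0 <= ln K by apply: ln_ge0.
have step i : (1 <= i)%N -> `|y i.+1 + (g - 1) * y i| <= ln K.
  move=> i1.
  have -> : y i.+1 + (g - 1) * y i = ln (X i.+2) - (ln (X i.+1) + ln (X i)).
    rewrite /y; move: (ln (X i.+2)) (ln (X i.+1)) (ln (X i)) => a b c.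
    transitivity (a - b - (g * g - g) * c); first by ring.
    by rewrite g2; ring.
  have [x0 x1 x2] := And3 (X0 i i1) (X0 i.+1 isT) (X0 i.+2 isT).
  have hlo : ln (X i.+1 * X i) <= ln (K * X i.+2) by rewrite ler_ln ?posrE ?mulr_gt0 ?lo.
  have hup : ln (X i.+2) <= ln (K * (X i.+1 * X i)) by rewrite ler_ln ?posrE ?mulr_gt0 ?up.
  move: hlo hup; rewrite !lnM ?posrE ?mulr_gt0 // => hlo hup.
  by rewrite ler_norml; apply/andP; split; lra.
(* [ln K / (2 - g)] is the fixed point of [t |-> (g - 1) t + ln K]. *)
have bnd i : `|y i.+1| <= M.
  elim: i => [|i IH].
    by rewrite /M lerDl divr_ge0 // subr_ge0 ltW.
  have := step i.+1 isT.
  have M0 : (2 - g) * `|y 1%N| + ln K = (2 - g) * M.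
    by rewrite /M; field; lra.
  have : 0 <= (2 - g) * `|y 1%N| by rewrite mulr_ge0 // subr_ge0 ltW.
  move: IH; rewrite !ler_norml => /andP[h1 h2] h3 /andP[h4 h5].
  by apply/andP; split; nra.
have key i : (1 <= i)%N -> X i.+1 = expR (y i) * X i `^ g.
  move=> i1; rewrite /powR gt_eqF ?X0 // -expRD /y subrK lnK //.
  by rewrite posrE X0.
exists (expR (- M)); exists (expR M).
split; [exact: expR_gt0 | exact: expR_gt0 | case=> [//|i] i1].
rewrite /= (key i.+1) //; have := bnd i; rewrite ler_norml => /andP[h1 h2].
by split; rewrite ler_wpM2r ?powR_ge0 ?ler_expR.
Qed.

(** Association only provides an unbounded sequence. Past a threshold the growth inequality makes it
    nondecreasing. *)
Lemma golden_growth_diverges (X : nat -> R) (c : R) : 0 < c ->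
  (forall i, (1 <= i)%N -> 0 < X i) ->
  (forall i, (1 <= i)%N -> c * X i `^ g <= X i.+1) ->
  (forall B, exists2 i, (1 <= i)%N & B < X i) ->
  forall B, exists2 i0, (1 <= i0)%N & forall i, (i0 <= i)%N -> B < X i.
Proof.
move=> c0 X0 lo unb B.
have [g2 g1 g3] := And3 golden_sqr golden_gt1 golden_lt2.
(* Beyond [c^(-g)] one has [c X^(g-1) >= 1], since [g (g-1) = 1]; hence [c X^g >= X]. *)
have [i0 i01 hi0] := unb (Num.max B (c^-1 `^ g)).
exists i0 => // i le_i.
suff : Num.max B (c^-1 `^ g) < X i by apply: le_lt_trans; rewrite le_max lexx.
elim: i le_i => [|i IH]; first by rewrite leqn0 => /eqP <-.
rewrite leq_eqVlt => /orP[/eqP <- //|]; rewrite ltnS => le_i.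
have i1 := leq_trans i01 le_i.
apply: lt_le_trans (IH le_i) (le_trans _ (lo _ i1)).
have : c^-1 `^ g < X i by apply: le_lt_trans (IH le_i); rewrite le_max lexx orbT.
move=> /ltW h.
have h2 : c^-1 <= X i `^ (g - 1).
  have : (c^-1 `^ g) `^ (g - 1) <= X i `^ (g - 1).
    by apply: ge0_ler_powR => //; rewrite ?nnegrE ?powR_ge0 ?subr_ge0 ?(ltW g1) ?(ltW (X0 _ i1)).
  by rewrite -powRrM mulrBr mulr1 g2 addrAC subrr add0r powRr1 // invr_ge0 ltW.
have -> : X i `^ g = X i * X i `^ (g - 1).
  transitivity (X i `^ 1 * X i `^ (g - 1)); last by rewrite powRr1 // ltW ?X0.
  rewrite -powRD; first by rewrite addrC subrK.
  by rewrite (gt_eqF (X0 _ i1)) implybT.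
rewrite mulrCA -[leLHS]mulr1 ler_pM2l ?X0 //.
by rewrite -ler_pdivrMl // mulr1.
Qed.
End Golden.

(** * Approximation and quadratic relations *)

Section Approximation.
Variables (R : realType) (xi : R).

(** Treats rational and quadratic numbers at once: [a = 0] is allowed. *)
Definition integer_quadratic_root : Prop := exists a b c : int,
  (a, b, c) <> (0, 0, 0) /\ a%:~R * xi ^+ 2 + b%:~R * xi + c%:~R = 0.

Lemma ratr_frac (q : rat) : (ratr q : R) = (numq q)%:~R / (denq q)%:~R.
Proof. by []. Qed.

Lemma rational_or_quadraticP :
  (Defs.rational xi \/ quadratic xi) <-> integer_quadratic_root.
Proof.
have den0 (q : rat) : ((denq q)%:~R : R) != 0 by rewrite intr_eq0 denq_neq0.
split=> [[[q xq]|[p [_ sp /rootP]]]|[a [b [c [nz e]]]]].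
- exists 0; exists (denq q); exists (- numq q); split.
    by move=> [/eqP]; rewrite (negPf (denq_neq0 q)).
  by rewrite xq ratr_frac mul0r add0r intrN mulrC divfK ?subrr.
- rewrite horner_coef size_map_poly sp !big_ord_recl big_ord0 !coef_map /= addr0.
  rewrite expr0 mulr1 expr1 !ratr_frac => e.
  exists (numq p`_2 * denq p`_0 * denq p`_1); exists (numq p`_1 * denq p`_0 * denq p`_2).
  exists (numq p`_0 * denq p`_1 * denq p`_2); split.
    move=> [/eqP]; rewrite !mulf_eq0 !(negPf (denq_neq0 _)) !orbF numq_eq0 => /eqP p2 _ _.
    have : lead_coef p != 0 by rewrite lead_coef_eq0 -size_poly_eq0 sp.
    by rewrite /lead_coef sp p2 eqxx.
  rewrite !intrM.
  have [d0 d1 d2] := And3 (den0 p`_0) (den0 p`_1) (den0 p`_2).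
  move: e d0 d1 d2; set n0 := (numq p`_0)%:~R; set n1 := (numq p`_1)%:~R;
    set n2 := (numq p`_2)%:~R.
  set k0 := (denq p`_0)%:~R; set k1 := (denq p`_1)%:~R; set k2 := (denq p`_2)%:~R => e d0 d1 d2.
  transitivity (k0 * k1 * k2 * (n0 / k0 + (n1 / k1 * xi + n2 / k2 * xi ^+ 2))).
    by field; rewrite d0 d1 d2.
  by rewrite e mulr0.
have inR (x : int) : (x%:~R : R) = ratr (x%:~R : rat) by rewrite ratr_int.
have [a0|a0] := eqVneq a 0.
  left; exists (- (c%:~R / b%:~R)).
  have b0 : (b%:~R : R) != 0.
    rewrite intr_eq0; apply/eqP => b0; apply: nz; rewrite a0 b0; congr (_, _, _).
    by move: e; rewrite a0 b0 !mul0r !add0r => /eqP; rewrite intr_eq0 => /eqP.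
  rewrite rmorphN fmorph_div /= !ratr_int.
  by move: e; rewrite a0 mul0r add0r => e; apply: (mulfI b0);
    rewrite mulrN mulrCA divff // mulr1; lra.
have aR0 : (a%:~R : R) != 0 by rewrite intr_eq0.
pose p : {poly rat} := Poly [:: c%:~R; b%:~R; a%:~R].
have pE : p = [:: c%:~R; b%:~R; a%:~R] :> seq rat.
  by rewrite (PolyK (c := 0)) //= intr_eq0.
have sp : size p = 3%N by rewrite pE.
(* If [p] has a rational root [r], then [xi] is [r] or the other root [-b/a - r], hence rational.
   Otherwise [p] is irreducible, being of degree 2. *)
have [[r /rootP rr]|nr] := pselect (exists r, root p r).
  left; move: rr; rewrite horner_coef sp !big_ord_recl big_ord0 pE /= addr0 expr0 mulr1 expr1
    => rr.
  have : ratr (c%:~R + (b%:~R * r + a%:~R * r ^+ 2)) = 0 :> R by rewrite rr rmorph0.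
  rewrite !(rmorphD, rmorphM, rmorphXn) /= !ratr_int => rR.
  have : (xi - ratr r) * (a%:~R * (xi + ratr r) + b%:~R) = 0.
    transitivity (a%:~R * xi ^+ 2 + b%:~R * xi + c%:~R - (c%:~R + (b%:~R * ratr r + a%:~R *
      ratr r ^+ 2))); first by ring.
    by rewrite rR e subrr.
  move/eqP; rewrite mulf_eq0 subr_eq0 => /orP[/eqP ->|/eqP h]; first by exists r.
  exists (- (b%:~R / a%:~R) - r).
  rewrite rmorphB rmorphN fmorph_div /= !ratr_int.
  apply: (mulfI aR0); rewrite mulrBr mulrN mulrCA divff // mulr1; lra.
right; exists p; split=> //.
  apply: cubic_irreducible; first by rewrite sp.
  by move=> r; apply/negP => rr; apply: nr; exists r.
apply/rootP; rewrite horner_coef size_map_poly sp !big_ord_recl big_ord0 !coef_map /= pE /=.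
by rewrite !ratr_int expr0 mulr1 expr1 addr0 -e; ring.
Qed.

Definition nrow (M : 'M[int]_2) : R := mx_norm (xi_row xi *m map_mx intr M).

Lemma xi_rowE (M : 'M[int]_2) j :
  (xi_row xi *m map_mx intr M) 0 j = xi * (M 0 j)%:~R - (M 1 j)%:~R.
Proof. by rewrite mulmx2E !mxE /= mulN1r. Qed.

Lemma nrow_ge (M : 'M[int]_2) j : `|xi * (M 0 j)%:~R - (M 1 j)%:~R| <= nrow M.
Proof. by rewrite -xi_rowE mx_norm_ge. Qed.

Lemma nrow_le (M : 'M[int]_2) c : 0 <= c ->
  (forall j, `|xi * (M 0 j)%:~R - (M 1 j)%:~R| <= c) -> nrow M <= c.
Proof.
by move=> c0 h; apply: mx_norm_le => // i j; rewrite [i]ord1 xi_rowE.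
Qed.

Lemma nrow_ge0 M : 0 <= nrow M. Proof. exact: mx_norm_ge0. Qed.

Lemma nrowM (A B : 'M[int]_2) : nrow (A *m B) <= 2 * nrow A * normZ R B.
Proof. by rewrite /nrow /normZ map_mxM /= mulmxA; apply: mx_normM. Qed.

(** Multiplying [(xi, -1) A] by the inverse of [A] returns the entry [-1]. This is the lower half of
    the estimate required by association. *)
Lemma nrow_lower (A : 'M[int]_2) : A \in unitmx -> 1 <= 2 * nrow A * normZ R A.
Proof.
move=> uA; rewrite -(normZ_invmx R uA); apply: le_trans (nrowM _ _).
rewrite mulmxV //; apply: le_trans (nrow_ge _ 1).
by rewrite !mxE /= mulr0 sub0r normrN normr1.
Qed.

Lemma twisted_not_integer_quadratic_root (W : nat -> 'M[int]_2) (N : 'M[int]_2) :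
  fibonacci_seq mulmx W -> (forall i, (1 <= i)%N -> W i \in unitmx) ->
  \det N <> 0 -> ~ symmetric_mx N ->
  (forall i, (1 <= i)%N -> symmetric_mx (W i *m twist N i)) ->
  (forall e : R, 0 < e -> exists2 i0, (1 <= i0)%N & forall i, (i0 <= i)%N -> nrow (W i) < e) ->
  ~ integer_quadratic_root.
Proof.
move=> fW uW dN sN sW small [a [b [c [nz e]]]]; apply: nz.
pose L (M : 'M[int]_2) := c * M 0 0 + b * M 0 1 + a * M 1 1.
(* Chosen so that [K * nrow (W i)] bounds [L] at [W_i N_i]; once this is below 1, the integer [L]
   vanishes. *)
pose K := (`|a%:~R| + `|a%:~R * xi| + `|b%:~R| + 1 : R) * (2 * (normZ R N + normZ R N^T + 1)).
have [n0 nt0] := (normZ_ge0 R N, normZ_ge0 R N^T).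
have K0 : 0 < K by rewrite mulr_gt0 ?mulr_gt0 ?ltr_wpDl ?addr_ge0.
have [i0 i01 hi0] := small K^-1 (eqbRL (invr_gt0 _) K0).
have L0 i : (i0 <= i)%N -> L (W i *m twist N i) = 0.
  move=> le_i; have i1 := leq_trans i01 le_i.
  set M := W i *m twist N i; have sM : M 1 0 = M 0 1.
    by have := congr1 (fun P : 'M[int]_2 => P 0 1) (sW i i1); rewrite mxE.
  have nM : nrow M <= 2 * nrow (W i) * (normZ R N + normZ R N^T + 1).
    apply: le_trans (nrowM _ _) _; apply: ler_wpM2l; first by rewrite mulr_ge0 ?nrow_ge0.
    by rewrite /twist; case: odd; lra.
  have := nrow_ge M 0; have := nrow_ge M 1; rewrite sM => h1 h0.
  have : `|(L M)%:~R : R| < 1.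
    have -> : (L M)%:~R = a%:~R * - (xi * (M 0 1)%:~R - (M 1 1)%:~R)
       - (a%:~R * xi) * (xi * (M 0 0)%:~R - (M 0 1)%:~R)
       - b%:~R * (xi * (M 0 0)%:~R - (M 0 1)%:~R).
      transitivity ((L M)%:~R - (M 0 0)%:~R * (a%:~R * xi ^+ 2 + b%:~R * xi + c%:~R)).
        by rewrite e mulr0 subr0.
      by rewrite /L !(intrD, intrM); ring.
    have hn : nrow (W i) * K < 1 by rewrite -lter_pdivlMr // div1r hi0.
    move: hn; rewrite /K; move: (a%:~R * xi) => al hn.
    apply: le_lt_trans hn; apply: le_trans (ler_normB _ _) _.
    apply: le_trans (lerD (ler_normB _ _) (lexx _)) _; rewrite !normrM normrN.
    have A0 := normr_ge0 (a%:~R : R); have B0 := normr_ge0 al; have C0 := normr_ge0 (b%:~R : R).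
    apply: (@le_trans _ _ ((`|a%:~R| + `|al| + `|b%:~R| + 1) * nrow M)); last first.
      rewrite mulrCA; apply: ler_wpM2l; first by rewrite !addr_ge0.
      by apply: le_trans nM _; rewrite mulrCA mulrA.
    rewrite !mulrDl mul1r -[leLHS]addr0; apply: lerD; last exact: nrow_ge0.
    by apply: lerD; [apply: lerD|]; apply: ler_wpM2l.
  by rewrite -intr_norm ltrz1 => h; apply/eqP; move: h; case: (L M) => [[|]|].
have d0 i : (1 <= i)%N -> \det (W i) <> 0.
  by move=> i1; case/unimodularP: (uW i i1) => ->.
have i2 : (i0 <= i0.+1)%N by []. have i3 : (i0 <= i0.+2)%N by rewrite ltnW.
have dt i : \det (twist N i) <> 0 by rewrite /twist; case: odd; rewrite ?det_tr.
have st i : ~ symmetric_mx (twist N i).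
  rewrite /twist; case: odd => // h; apply: sN.
  by move: h; rewrite /symmetric_mx trmxK.
(* The twist has period 2, so three consecutive points have the shape [Z], [W N], [W Z]. *)
have e2 : W i0.+2 *m twist N i0.+2 = W i0.+1 *m (W i0 *m twist N i0).
  have -> : twist N i0.+2 = twist N i0 by rewrite (twistS N i0.+1) (twistS N i0) trmxK.
  by rewrite fW // mulmxA.
have [|||||||||-> -> -> //] := @consecutive_independent a b c (W i0 *m twist N i0) (W i0.+1)
  (twist N i0.+1).
- by apply/eqP; rewrite det_mulmx mulf_neq0 //; apply/eqP => //; apply: d0.
- exact: d0.
- exact: st.
- exact: sW.
- exact: sW.
- by rewrite -e2; apply: sW.
- exact: L0.
- exact: L0.
- by rewrite -e2; apply: L0.
Qed.

End Approximation.

(** * Extremality *)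

Section Associated.
Variables (R : realType) (xi : R) (W : nat -> 'M[int]_2).
Hypothesis uW : forall i, (1 <= i)%N -> W i \in unitmx.
Hypothesis aW : associated xi W.
Local Notation X := (fun i => normZ R (W i)).
Local Notation g := (golden R).

Lemma associated_norm_diverges (B : R) :
  exists2 i0, (1 <= i0)%N & forall i, (i0 <= i)%N -> B < X i.
Proof.
have [unb _ [c1 [c2 [c10 _ h]]] _ _] := aW.
apply: (golden_growth_diverges c10) unb B => i i1; last by have [] := h i i1.
exact: lt_le_trans (normZ_unimodular_ge1 R (uW i1)).
Qed.

Lemma associated_nrow_le : exists2 c : R, 0 < c &
  forall i, (1 <= i)%N -> nrow xi (W i) <= c * (X i)^-1.
Proof.
have [_ _ _ [c1 [c2 [_ c20 h]]] _] := aW.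
by exists c2 => // i i1; have [] := h i i1.
Qed.

Lemma associated_nrow_small (e : R) : 0 < e ->
  exists2 i0, (1 <= i0)%N & forall i, (i0 <= i)%N -> nrow xi (W i) < e.
Proof.
move=> e0; have [c c0 hc] := associated_nrow_le.
have [i0 i01 hi0] := associated_norm_diverges (c / e).
exists i0 => // i le_i; have i1 := leq_trans i01 le_i.
apply: le_lt_trans (hc _ i1) _.
have X0 : 0 < X i by apply: lt_le_trans (normZ_unimodular_ge1 R (uW i1)).
by rewrite ltr_pdivrMr // mulrC -ltr_pdivrMr // hi0.
Qed.

Hypothesis fW : fibonacci_seq mulmx W.

(** For a bound [Y] with [K X_j <= Y < K X_{j+1}], the entries of the symmetric matrix [W_j N_j]
    solve the system: the errors are of order [1 / X_j], and [X_{j+1}] is at most of order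
    [X_j^g]. *)
Lemma extremal_of_associated : extremal xi.
Proof.
have [_ [N [[_ dN] sN _ sW]] [c1 [c2 [c10 c20 hX]]] _ _] := aW.
have nalg := twisted_not_integer_quadratic_root fW uW dN sN sW associated_nrow_small.
have [r r0 hr] := associated_nrow_le.
split=> [h|h|]; [by apply: nalg; apply/rational_or_quadraticP; left |
  by apply: nalg; apply/rational_or_quadraticP; right |].
have X1 i : (1 <= i)%N -> 1 <= X i by move=> i1; exact: normZ_unimodular_ge1 (uW i1).
have [K K1 nt] : exists2 K : R, 1 <= K & forall i, 2 * normZ R (twist N i) <= K.
  exists (2 * (normZ R N + normZ R N^T + 1)) => [|i].
    by have := normZ_ge0 R N; have := normZ_ge0 R N^T; lra.
  have := normZ_ge0 R N; have := normZ_ge0 R N^T.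
  by rewrite /twist; case: odd; lra.
have K0 : 0 < K by apply: lt_le_trans K1.
have g1 := golden_gt1 R; have gi := golden_inv R.
have gV0 : 0 <= g^-1 by rewrite gi subr_ge0 ltW.
(* The first summand serves the range [Y < K X_1], where [(0, 1, 0)] is a solution; in the second
   one, the factor [1 + |xi|] pays for passing from [xi] to [xi^2]. *)
pose c0 := (K * X 1%N) `^ g^-1 + (1 + `|xi|) * K * r * (K * c2) `^ g^-1.
have KX0 i : (1 <= i)%N -> 0 < K * X i by move=> i1;
  rewrite mulr_gt0 // (lt_le_trans ltr01 (X1 _ i1)).
have c00 : 0 < c0.
  apply: ltr_wpDr; last by rewrite powR_gt0 // KX0.
  by rewrite !mulr_ge0 ?addr_ge0 ?powR_ge0 // ltW.
exists c0 => // Y Y1.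
have Y0 : 0 < Y by apply: lt_le_trans Y1.
have Yg0 : 0 < Y `^ g^-1 by rewrite powR_gt0.
have [i0 i01 hi0] := associated_norm_diverges (Y / K).
have exj : exists j, Y < K * X j.+1.
  by exists i0.-1; rewrite prednK // mulrC -ltr_pdivrMr // hi0.
case: (ex_minnP exj) => -[|j] hj minj.
  exists 0, 1, 0; rewrite !mul0r !sub0r !normrN normr1 normr0 powRN.
  split=> //; first exact: ltW.
    rewrite ler_pdivlMr // mul1r; apply: (@le_trans _ _ ((K * X 1%N) `^ g^-1)).
      by apply: ge0_ler_powR; rewrite // ?nnegrE ?ltW ?KX0.
    by rewrite /c0 lerDl !mulr_ge0 ?addr_ge0 ?powR_ge0 // ltW.
  by rewrite mulr_ge0 // ltW // invr_gt0.
have hj1 : K * X j.+1 <= Y.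
  by rewrite leNgt; apply/negP => /minj; rewrite ltnn.
set M := W j.+1 *m twist N j.+1.
have sM : M 1 0 = M 0 1.
  by have := congr1 (fun P : 'M[int]_2 => P 0 1) (sW j.+1 isT); rewrite mxE.
have Xj := X1 j.+1 isT; have Xj0 : 0 < X j.+1 by apply: lt_le_trans Xj.
have nM : normZ R M <= K * X j.+1.
  apply: le_trans (normZM _ _ _) _; by rewrite mulrAC ler_wpM2r // ltW.
have rM : nrow xi M <= K * r * (X j.+1)^-1.
  apply: le_trans (nrowM _ _ _) _; rewrite mulrAC -[leRHS]mulrA.
  apply: ler_pM; rewrite ?mulr_ge0 ?normZ_ge0 ?nrow_ge0 //.
  exact: hr.
have key : K * r * (X j.+1)^-1 <= K * r * (K * c2) `^ g^-1 * Y `^ (- g^-1).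
  rewrite -[leRHS]mulrA; apply: ler_wpM2l; first by rewrite mulr_ge0 // ltW.
  rewrite powRN -[leLHS]mul1r ler_pdivlMr // mulrAC ler_pdivrMr // mul1r.
  have : Y `^ g^-1 <= (K * (c2 * X j.+1 `^ g)) `^ g^-1.
    apply: ge0_ler_powR; rewrite ?nnegrE //; first exact: ltW.
      by rewrite !mulr_ge0 ?powR_ge0 // ltW.
    apply: (le_trans (ltW hj)); apply: ler_wpM2l; first exact: ltW.
    by have [] := hX j.+1 isT.
  rewrite mulrA powRM ?powR_ge0 ?mulr_ge0 ?(ltW K0) ?(ltW c20) //.
  by rewrite -powRrM divff ?powRr1 ?(ltW Xj0) // gt_eqF // (lt_trans ltr01 g1).
have P0 : 0 <= (K * r * (K * c2) `^ g^-1) * Y `^ (- g^-1).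
  by rewrite !mulr_ge0 ?powR_ge0 // ltW.
have Q0 : 0 <= (K * X 1%N) `^ g^-1 * Y `^ (- g^-1) by rewrite mulr_ge0 ?powR_ge0.
have rK := le_trans rM key.
have c0E : c0 * Y `^ (- g^-1) = (K * X 1%N) `^ g^-1 * Y `^ (- g^-1)
   + (1 + `|xi|) * ((K * r * (K * c2) `^ g^-1) * Y `^ (- g^-1)) by rewrite /c0; ring.
exists (M 0 0), (M 0 1), (M 1 1).
have x0 := normr_ge0 xi.
have h0 := nrow_ge xi M 0; have h1 := nrow_ge xi M 1.
split.
- case=> M00 M01 M11.
  have : \det M = 0 by rewrite det2E sM M00 M01 M11; ring.
  rewrite det_mulmx => /eqP; rewrite mulf_eq0 => /orP[|].
    by case/unimodularP: (@uW j.+1 isT) => ->.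
  by rewrite /twist; case: odd; rewrite ?det_tr; move/eqP.
- exact: le_trans (normZ_ge R M 0 0) (le_trans nM hj1).
- rewrite mulrC -sM; apply: (le_trans h0); apply: (le_trans rK); rewrite c0E.
  move: P0 Q0; move: (K * r * _ * _) (_ `^ g^-1 * _) => P Q; nra.
- have -> : (M 0 0)%:~R * xi ^+ 2 - (M 1 1)%:~R =
      xi * (xi * (M 0 0)%:~R - (M 1 0)%:~R) + (xi * (M 0 1)%:~R - (M 1 1)%:~R).
    by rewrite sM; ring.
  apply: le_trans (ler_normD _ _) _; rewrite normrM.
  move: P0 Q0 rK; rewrite c0E; move: (K * r * _ * _) (_ `^ g^-1 * _) => P Q P0 Q0 rK.
  have := le_trans h0 rK; have := le_trans h1 rK => k1 k0.
  apply: (@le_trans _ _ (`|xi| * P + P)); last by nra.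
  by apply: lerD => //; apply: ler_wpM2l.
Qed.
End Associated.

(** * Matrices of words *)

Definition letter_mx (a : int) : 'M[int]_2 := mx2 0 1 1 a.

Definition word_mx (w : seq posnat) : 'M[int]_2 :=
  foldr (fun a M => letter_mx (val a)%:Z *m M) 1%:M w.

Lemma word_mx_cat w1 w2 : word_mx (w1 ++ w2) = word_mx w1 *m word_mx w2.
Proof. by elim: w1 => [|a w1 IH] /=; rewrite ?mul1mx // IH mulmxA. Qed.

Lemma letter_mx_unit a : letter_mx a \in unitmx.
Proof. by apply/unimodularP; right; rewrite det_mx2; ring. Qed.

Lemma word_mx_unit w : word_mx w \in unitmx.
Proof. by elim: w => [|a w IH] /=; rewrite ?unitmx1 // unitmx_mul letter_mx_unit. Qed.

Lemma word_mx_nil : word_mx [::] = mx2 1 0 0 1.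
Proof. by apply: matrix2P; rewrite !mxE. Qed.

Lemma word_mx_cons a w (M := word_mx w) :
  word_mx (a :: w) = mx2 (M 1 0) (M 1 1) (M 0 0 + (val a)%:Z * M 1 0) (M 0 1 + (val a)%:Z * M 1
    1).
Proof. by rewrite /= -/M [M in LHS]mx2_eta mul_mx2; congr mx2; ring. Qed.

(** Monotone entries characterise the matrices of non-empty words inside GL_2(Z); [word_mx_surj] is
    the converse. *)
Lemma word_mx_entries w (M := word_mx w) : w <> [::] ->
  [/\ 0 <= M 0 0, M 0 0 <= M 0 1, M 0 0 <= M 1 0, M 0 1 <= M 1 1 & M 1 0 <= M 1 1] /\
  [/\ 1 <= M 0 1, 1 <= M 1 0 & 1 <= M 1 1].
Proof.
rewrite {}/M; elim: w => // a w IH _; rewrite word_mx_cons.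
have a1 : 1 <= (val a)%:Z :> int by have := valP a.
move: ((val a)%:Z) a1 => {a} a a1.
case: w IH => [_|b w IH]; first by rewrite word_mx_nil !mxE /=; split; split; lia.
have nz : b :: w <> [::] by [].
have := IH nz; move: (word_mx (b :: w)) => M; rewrite !mxE /=.
move=> [[h1 h2 h3 h4 h5] [h6 h7 h8]].
have : M 1 0 <= a * M 1 0 by nia.
have : M 1 1 <= a * M 1 1 by nia.
have : a * M 1 0 <= a * M 1 1 by apply: ler_wpM2l; lia.
by split; split; lia.
Qed.

Lemma word_mx_trace w : w <> [::] ->
  (\det (word_mx w) = 1 /\ 3 <= word_mx w 0 0 + word_mx w 1 1) \/
  (\det (word_mx w) = -1 /\ 1 <= word_mx w 0 0 + word_mx w 1 1).
Proof.
move=> w0; have [] := word_mx_entries w0.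
case/unimodularP: (word_mx_unit w); rewrite det2E;
  move: (word_mx w 0 0) (word_mx w 0 1) (word_mx w 1 0) (word_mx w 1 1) => a b c d e.
  move=> [h1 h2 h3 h4 h5] [h6 h7 h8]; left; split=> //.
  have p1 : 1 <= b * c by nia.
  have a1 : 1 <= a by nia.
  have d2 : 2 <= d by nia.
  lia.
by move=> [h1 h2 h3 h4 h5] [h6 h7 h8]; right; split=> //; lia.
Qed.

Lemma word_mx_inj w w' : word_mx w = word_mx w' -> w = w'.
Proof.
(* Distinct words already differ on the column vector (1, 2). *)
pose u w := word_mx w 0 0 + 2 * word_mx w 0 1.
pose v w := word_mx w 1 0 + 2 * word_mx w 1 1.
have uc a w1 : u (a :: w1) = v w1 by rewrite /u word_mx_cons !mxE.
have vc a w1 : v (a :: w1) = u w1 + (val a)%:Z * v w1.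
  by rewrite /v word_mx_cons !mxE /= /u; ring.
have uv w1 : 0 < u w1 /\ u w1 < v w1.
  elim: w1 => [|a w1 [IH1 IH2]]; first by rewrite /u /v word_mx_nil !mxE.
  by rewrite uc vc; have := valP a; set k := val a => /= k1; split; nia.
suff key w1 w2 : u w1 = u w2 -> v w1 = v w2 -> w1 = w2.
  by move=> e; apply: key; rewrite /u /v e.
elim: w1 w2 => [|a w1 IH] [|b w2] //.
- by rewrite uc => e; have [] := uv w2; rewrite -e /u word_mx_nil !mxE /=; lia.
- by rewrite uc => e; have [] := uv w1; rewrite e /u word_mx_nil !mxE /=; lia.
rewrite !uc !vc => ev eu; rewrite ev in eu.
have [u1 v1] := uv w1; have [u2 v2] := uv w2; rewrite ev in v1.
(* Both letters are the quotient of one Euclidean division by [v w2], since [u w1] and [u w2] lie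
   strictly between 0 and this divisor. *)
have ab : val a = val b.
  by move: eu v1 v2 u1 u2; set x := val a; set y := val b; move: (u w1) (u w2) (v w2) => *; nia.
by rewrite (val_inj ab) (IH w2) //; move: eu; rewrite ab => /addIr.
Qed.

(** Induction on the bottom right entry [d]. Removing the first letter [k] leaves [[s r; a b]],
    whose bottom right entry [b] is smaller than [d]. *)
Lemma word_mx_surj (M : 'M[int]_2) : M \in unitmx ->
  0 <= M 0 0 -> M 0 0 <= M 0 1 -> M 0 0 <= M 1 0 -> M 0 1 <= M 1 1 -> M 1 0 <= M 1 1 ->
  1 <= M 1 1 -> exists w, M = word_mx w /\ w <> [::].
Proof.
have letter (k : int) : 1 <= k -> exists a : posnat, (val a)%:Z = k.
  case: k => [[|n]|] // _.
  by exists (exist _ n.+1 isT).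
move=> /unimodularP; have [m] := ubnP (absz (M 1 1)); elim: m M => // m IH M.
rewrite det2E; have := mx2_eta M.
move: (M 0 0) (M 0 1) (M 1 0) (M 1 1) => a b c d ->.
move=> dm dt a0 ab ac bd cd d1.
have [az|a1] : a = 0 \/ 1 <= a by lia.
  have [b1 c1] : b = 1 /\ c = 1.
    move: dt; rewrite az mul0r; have [b0 c0] : 0 <= b /\ 0 <= c by split; lia.
    case=> dt; first by nia.
    have bc : b * c = 1 by lia.
    have [b0' c0'] : 1 <= b /\ 1 <= c by split;
      [case: (b) b0 bc => [[|?]|?]|case: (c) c0 bc => [[|?]|?]]; lia.
    by split; nia.
  have [k ek] := letter d d1.
  by exists [:: k]; split=> //; rewrite word_mx_cons word_mx_nil !mxE /= ek az b1 c1;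
    congr mx2; ring.
have [b1|b2] : b = 1 \/ 2 <= b by lia.
  have [a1' ec] : a = 1 /\ c = d - 1 by have a1' : a = 1 by [lia]; move: dt; rewrite b1 a1';
    split; lia.
  have [k ek] : exists k : posnat, (val k)%:Z = d - 1 by apply: letter; lia.
  exists [:: k; exist _ 1%N isT]; split=> //.
  by rewrite !word_mx_cons word_mx_nil !mxE /= ek a1' b1 ec; congr mx2; ring.
(* Euclid's algorithm on the last column; the case [b = 1] is set apart
   since the quotient [d] then exceeds the first letter by 1. *)
pose k := (d %/ b)%Z; pose r := (d %% b)%Z.
have dE : d = k * b + r by rewrite /k /r -divz_eq.
have r0 : 0 <= r by apply: modz_ge0; lia.
have rb : r < b by apply: ltz_pmod; lia.
have k1 : 1 <= k by nia.
pose s := c - k * a.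
have rs : b * s = a * r - (a * d - b * c) by rewrite /s dE; ring.
(* A determinant of absolute value 1 is no multiple of [b >= 2]; this excludes [a = b], [r = 0] and
   [b = d]. *)
have nmul t : a * d - b * c <> b * t by move=> e; rewrite e in dt; clear -dt b2;
  have [|[|]] : t <= -1 \/ t = 0 \/ 1 <= t by [lia]; case: dt; nia.
have ab' : a < b.
  have [e|//] : a = b \/ a < b by lia.
  by case: (nmul (d - c)); rewrite e; ring.
have r1 : 1 <= r.
  have [r00|//] : r = 0 \/ 1 <= r by lia.
  by case: (nmul (a * k - c)); rewrite dE r00; ring.
have rs' : b * s = a * r - 1 \/ b * s = a * r + 1 by case: dt rs => -> ->; lia.
have ar : 1 <= a * r by nia.
have ar1 : a * r <= a * b - a by nia.
have ar2 : a * r <= b * r - r by nia.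
have s0 : 0 <= s by clear -rs' ar b2; nia.
have sr : s <= r by clear -rs' ar2 b2 r1; nia.
have sa : s <= a by clear -rs' ar1 b2 a1; nia.
have bd' : b < d.
  have [e|//] : b = d \/ b < d by lia.
  by case: (nmul (a - c)); rewrite -e; ring.
have [x ex] := letter k k1.
have [||||||||w [ew w0]] := IH (mx2 s r a b).
- by rewrite !mxE /=; lia.
- have -> : \det (mx2 s r a b) = - (a * d - b * c) by rewrite det_mx2 /s dE; ring.
  by case: dt => ->; [right | left].
- by rewrite !mxE.
- by rewrite !mxE.
- by rewrite !mxE.
- by rewrite !mxE /=; lia.
- by rewrite !mxE.
- by rewrite !mxE /=; lia.
by exists (x :: w); split=> //; rewrite word_mx_cons -ew !mxE /= ex; congr mx2; rewrite /s ?dE;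
  ring.
Qed.

(** * Continued fractions *)

Section ContinuedFraction.
Variable R : realType.
Implicit Types (x y z mu nu : R) (M N : 'M[int]_2) (w : seq posnat).

(* [(x, -1) M = mu (z, -1)]. *)
Definition carries M x z mu : Prop :=
  x * (M 0 0)%:~R - (M 1 0)%:~R = mu * z /\ x * (M 0 1)%:~R - (M 1 1)%:~R = - mu.

Lemma carries1 x : carries 1%:M x x 1.
Proof. by rewrite /carries !mxE /=; split; ring. Qed.

Lemma carriesM M N x y z mu nu :
  carries M x y mu -> carries N y z nu -> carries (M *m N) x z (mu * nu).
Proof.
rewrite /carries !mulmx2E !(intrD, intrM).
move: (M 0 0)%:~R (M 0 1)%:~R (M 1 0)%:~R (M 1 1)%:~R => a b c d.
move: (N 0 0)%:~R (N 0 1)%:~R (N 1 0)%:~R (N 1 1)%:~R => e f g h [e1 e2] [e3 e4].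
split.
  transitivity ((x * a - c) * e + (x * b - d) * g); first by ring.
  by rewrite e1 e2 -[RHS]mulrA -e3; ring.
transitivity ((x * a - c) * f + (x * b - d) * h); first by ring.
by rewrite e1 e2 -[RHS]mulrN -e4; ring.
Qed.

(** For [a] the floor of [x] this is one step of the continued fraction algorithm. *)
Lemma carries_letter (a : int) x : x - a%:~R != 0 ->
  carries (letter_mx a) x (x - a%:~R)^-1 (- (x - a%:~R)).
Proof. by move=> nz; rewrite /carries !mxE /= mulNr divff // mulr0 mulr1 sub0r opprK. Qed.

Lemma unimodular_ker M (u v : R) : M \in unitmx ->
  u * (M 0 0)%:~R + v * (M 1 0)%:~R = 0 -> u * (M 0 1)%:~R + v * (M 1 1)%:~R = 0 ->
  u = 0 /\ v = 0.
Proof.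
move=> /unimodularP; rewrite det2E => dM.
have : ((M 0 0 * M 1 1 - M 0 1 * M 1 0)%:~R : R) != 0 by case: dM => ->;
  rewrite ?intrN ?oppr_eq0 oner_neq0.
rewrite intrB !intrM; move: (M 0 0)%:~R (M 0 1)%:~R (M 1 0)%:~R (M 1 1)%:~R => a b c d nz e1 e2.
split; apply: (mulfI nz); rewrite mulr0.
  transitivity ((u * a + v * c) * d - (u * b + v * d) * c); first by ring.
  by rewrite e1 e2; ring.
transitivity ((u * b + v * d) * a - (u * a + v * c) * b); first by ring.
by rewrite e1 e2; ring.
Qed.

(** The combination [nu (x, -1) - mu (y, -1)] lies in the left kernel of [M]. *)
Lemma carries_source_uniq M x y z mu nu : M \in unitmx -> mu != 0 ->
  carries M x z mu -> carries M y z nu -> x = y.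
Proof.
move=> uM mu0 [e1 e2] [e3 e4].
have [||h1 h2] := @unimodular_ker M (nu * x - mu * y) (mu - nu) uM.
- transitivity (nu * (x * (M 0 0)%:~R - (M 1 0)%:~R) - mu * (y * (M 0 0)%:~R - (M 1 0)%:~R));
  first by ring.
  by rewrite e1 e3; ring.
- transitivity (nu * (x * (M 0 1)%:~R - (M 1 1)%:~R) - mu * (y * (M 0 1)%:~R - (M 1 1)%:~R));
  first by ring.
  by rewrite e2 e4; ring.
have e : mu = nu by lra.
by apply: (mulfI mu0); move: h1; rewrite -e; lra.
Qed.

Lemma carries_irrational M x z mu : M \in unitmx -> mu != 0 -> carries M x z mu ->
  ~ Defs.rational x -> ~ Defs.rational z.
Proof.
move=> uM mu0 [e1 e2] ix [q zq]; apply: ix.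
pose den : rat := (M 0 0)%:~R + q * (M 0 1)%:~R.
pose num : rat := (M 1 0)%:~R + q * (M 1 1)%:~R.
have e : x * ratr den = ratr num.
  rewrite !(rmorphD, rmorphM) /= !ratr_int -zq.
  have : x * (M 0 0)%:~R - (M 1 0)%:~R + z * (x * (M 0 1)%:~R - (M 1 1)%:~R) = 0.
    by rewrite e1 e2; ring.
  by move=> h; apply/eqP; rewrite -subr_eq0; apply/eqP; rewrite -h; ring.
have [d0|d0] := eqVneq den 0; last first.
  by exists (num / den); rewrite fmorph_div /= -e mulfK // fmorph_eq0.
have n0 : num = 0.
  have : ratr num = 0 :> R by rewrite -e d0 rmorph0 mulr0.
  by move/eqP; rewrite fmorph_eq0 => /eqP.
have : ((\det M)%:~R : rat) = 0.
  rewrite det2E intrB !intrM.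
  transitivity (den * (M 1 1)%:~R - (M 0 1)%:~R * num); first by rewrite /den /num; ring.
  by rewrite d0 n0 mul0r mulr0 subr0.
by case/unimodularP: uM => ->.
Qed.

Lemma complete_quotientD x k n : complete_quotient x (k + n) =
  obind (fun z => complete_quotient z n) (complete_quotient x k).
Proof.
elim: n => [|n IH]; first by rewrite addn0; case: complete_quotient.
by rewrite addnS /= IH; case: complete_quotient.
Qed.

Lemma partial_quotientD x k z n : complete_quotient x k = Some z ->
  partial_quotient x (k + n) = partial_quotient z n.
Proof. by rewrite /partial_quotient complete_quotientD => ->. Qed.

(** The value of the continued fraction [[a_1, ..., a_n, z]], where [w = a_1 ... a_n]. *)
Definition act w z : R := foldr (fun a y => (val a)%:R + y^-1) z w.

Lemma letter_ge1 (a : posnat) : 1 <= (val a)%:R :> R.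
Proof. by rewrite ler1n; exact: valP. Qed.

Lemma act_gt0 w z : 0 < z -> 0 < act w z.
Proof.
move=> z0; elim: w => //= a w IH.
by rewrite ltr_pwDl ?invr_ge0 ?(ltW IH) // (lt_le_trans ltr01) ?letter_ge1.
Qed.

Lemma act_gt1 w z : 1 < z -> 1 < act w z.
Proof.
move=> z1; case: w => //= a w.
by rewrite ltr_pwDr ?letter_ge1 // invr_gt0 act_gt0 // (lt_trans ltr01).
Qed.

Lemma carries_act w z : 0 < z -> exists2 mu, mu != 0 & carries (word_mx w) (act w z) z mu.
Proof.
move=> z0; elim: w => [|a w [mu mu0 IH]] /=; first by exists 1; rewrite ?oner_neq0 //;
  apply: carries1.
set y := act w z in IH *; have y0 : y != 0 by rewrite gt_eqF // act_gt0.
exists (- y^-1 * mu); first by rewrite mulf_neq0 ?oppr_eq0 ?invr_neq0.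
apply: carriesM IH.
have := @carries_letter (val a)%:Z ((val a)%:R + y^-1).
by rewrite -pmulrn addrAC subrr add0r invrK; apply; rewrite invr_neq0.
Qed.

Lemma complete_quotient_act w z : 1 < z -> complete_quotient (act w z) (size w) = Some z /\
  forall n, (n < size w)%N ->
    partial_quotient (act w z) n = omap (fun a : posnat => (val a)%:Z) (onth w n).
Proof.
move=> z1; elim: w => [|a w [IH1 IH2]] //.
have y1 := act_gt1 w z1; have y0 : 0 < act w z by apply: lt_trans y1.
have fl : Num.floor (act (a :: w) z) = (val a)%:Z.
  apply: floor_def; rewrite /= intrD -pmulrn.
  by rewrite lerDl invr_ge0 (ltW y0) /= ltrD2l invf_lt1.
have cq1 : complete_quotient (act (a :: w) z) 1 = Some (act w z).
  rewrite [LHS]/=; rewrite [Num.floor _]fl -pmulrn addrAC subrr add0r invrK.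
  by rewrite invr_eq0 gt_eqF.
split; first by rewrite (complete_quotientD _ 1 (size w)) cq1.
case=> [_|n n_lt]; first by rewrite /partial_quotient [LHS]/= fl.
by rewrite -[n.+1]add1n (partial_quotientD _ cq1) IH2.
Qed.

Lemma act_of_quotients w x z : complete_quotient x (size w) = Some z ->
  (forall n, (n < size w)%N ->
    partial_quotient x n = omap (fun a : posnat => (val a)%:Z) (onth w n)) ->
  x = act w z.
Proof.
elim: w x => [|a w IH] x /=; first by case.
move=> cq pq; have := pq 0%N isT; rewrite /partial_quotient /= => -[fl].
have : complete_quotient x (1 + size w) = Some z by [].
rewrite complete_quotientD [complete_quotient x 1]/=; case: eqP => //= /eqP nz cqz.
rewrite -(IH _ cqz); first by rewrite invrK fl -pmulrn; ring.
move=> n n_lt; rewrite -(pq n.+1 n_lt) -[n.+1]add1n (@partial_quotientD _ _ (x - (Num.floor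
  x)%:~R)^-1) //=.
by rewrite (negPf nz).
Qed.

Lemma complete_quotient_carries x k z : complete_quotient x k = Some z ->
  exists A mu, [/\ A \in unitmx, mu != 0 & carries A x z mu].
Proof.
elim: k z => [|k IH] z /=.
  by case=> <-; exists 1%:M, 1; rewrite unitmx1 oner_neq0; split=> //; apply: carries1.
case E: complete_quotient => [y|] //; case: eqP => // /eqP nz [<-].
have [A [mu [uA mu0 cA]]] := IH _ E.
exists (A *m letter_mx (Num.floor y)), (mu * - (y - (Num.floor y)%:~R)).
rewrite unitmx_mul uA letter_mx_unit mulf_neq0 ?oppr_eq0 //; split=> //.
exact: carriesM cA (carries_letter nz).
Qed.

(** The columns of [A] are two successive convergents with the denominators on top; up to sign,
    [mu z] and [mu] are their errors. The index [k] starts at 1, so that [1 < z] can hold. *)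
Definition convergent x (k : nat) (A : 'M[int]_2) z mu : Prop :=
  [/\ complete_quotient x k = Some z, A \in unitmx, mu != 0, carries A x z mu & 1 < z] /\
  [/\ 0 <= A 0 0, A 0 0 <= A 0 1, 1 <= A 0 1, `|mu| <= 1 & `|mu * z| <= 1].

Lemma floor_frac_irrational z : ~ Defs.rational z ->
  0 < z - (Num.floor z)%:~R /\ z - (Num.floor z)%:~R < 1.
Proof.
move=> iz; have /andP[h1 h2] := floor_itv z.
rewrite subr_gt0 lt_neqAle h1 andbT; split.
  by apply/eqP => e; apply: iz; exists (Num.floor z)%:~R; rewrite ratr_int e.
by rewrite ltrBlDl -intrD1.
Qed.

Lemma convergent1 x : ~ Defs.rational x -> exists A z mu, convergent x 1 A z mu.
Proof.
move=> ix; have [f0 f1] := floor_frac_irrational ix.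
exists (letter_mx (Num.floor x)), (x - (Num.floor x)%:~R)^-1, (- (x - (Num.floor x)%:~R)).
have nz := gt_eqF f0.
split; split; rewrite ?letter_mx_unit ?oppr_eq0 ?nz // ?mxE //=.
- by rewrite nz.
- by apply: carries_letter; rewrite nz.
- by rewrite invf_gt1.
- by rewrite normrN gtr0_norm // ltW.
- by rewrite mulNr divff ?nz // normrN normr1.
Qed.

Lemma convergentS x k A z mu : ~ Defs.rational x -> convergent x k A z mu ->
  exists A' z' mu', [/\ convergent x k.+1 A' z' mu', A' 0 0 = A 0 1 & A 0 0 + A 0 1 <= A' 0 1].
Proof.
move=> ix [[cq uA mu0 cA z1] [a0 ab b1 m1 m2]].
have iz := carries_irrational uA mu0 cA ix.
have [f0 f1] := floor_frac_irrational iz; have nz := gt_eqF f0.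
have fl : 1 <= Num.floor z.
  by rewrite floor_ge_int (ltW z1).
have eA' j : (A *m letter_mx (Num.floor z)) 0 j = if j == 0 then A 0 1 else A 0 0 + A 0 1 *
  Num.floor z.
  by rewrite mulmx2E !mxE /=; case: ifP => _; ring.
exists (A *m letter_mx (Num.floor z)), (z - (Num.floor z)%:~R)^-1,
  (mu * - (z - (Num.floor z)%:~R)).
split; rewrite ?eA' /=; [|by []|nia].
split; split; rewrite ?eA' //=.
- by rewrite cq nz.
- by rewrite unitmx_mul uA letter_mx_unit.
- by rewrite mulf_neq0 ?oppr_eq0 ?nz.
- by apply: carriesM cA (carries_letter _); rewrite nz.
- by rewrite invf_gt1.
- by lia.
- by nia.
- by nia.
- by rewrite normrM normrN -[leRHS]mulr1 ler_pM // gtr0_norm // ltW.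
- by rewrite mulrN mulNr mulfK ?nz // normrN.
Qed.

(** Two steps of the algorithm increase both the smaller denominator and the gap between the two. *)
Lemma convergent_large x (m : nat) : ~ Defs.rational x ->
  exists k A z mu, [/\ convergent x k A z mu, m%:Z <= A 0 0 & A 0 0 + m%:Z <= A 0 1].
Proof.
move=> ix; elim: m => [|m [k [A [z [mu [cA h1 h2]]]]]].
  by have [A [z [mu cA]]] := convergent1 ix; exists 1%N, A, z, mu; case: (cA) => _ [] *;
    split=> //; lia.
have [A1 [z1 [mu1 [c1 e1 l1]]]] := convergentS ix cA.
have [A2 [z2 [mu2 [c2 e2 l2]]]] := convergentS ix c1.
have [_ [a0 ab b1 _ _]] := cA.
by exists k.+2, A2, z2, mu2; split=> //; lia.
Qed.
End ContinuedFraction.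

(** * Fibonacci words *)

Section FibonacciWords.
Variable (E : Type) (w : nat -> seq E).
Hypothesis fw : fibonacci_seq cat w.

Lemma fibonacci_word_neq0 : w 1%N <> [::] -> w 2%N <> [::] ->
  forall i, (1 <= i)%N -> w i <> [::].
Proof.
move=> w1 w2; have both i : w i.+1 <> [::] /\ w i.+2 <> [::].
  elim: i => [|i [h1 h2]] //; split=> //; rewrite fw //.
  by case: (w i.+2) h2.
by case=> // i _; have [] := both i.
Qed.

Lemma onth_fibonacci_prefix i j n : (2 <= i)%N -> (i <= j)%N -> (n < size (w i))%N ->
  onth (w j) n = onth (w i) n.
Proof.
move=> i2 /subnKC <- n_lt; suff [h _] : onth (w (i + (j - i))) n = onth (w i) n /\
    (n < size (w (i + (j - i))))%N by [].
elim: (j - i)%N => [|m [IH1 IH2]]; first by rewrite addn0.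
have -> : w (i + m.+1)%N = w (i + m)%N ++ w (i + m).-1.
  case: i i2 {n_lt IH1 IH2} => [|[|i]] // _.
  by rewrite addnS !addSn /= fw // addSn.
by rewrite onth_cat IH2 IH1 size_cat ltn_addr.
Qed.

(** Indices start at 2, since [w_2] need not begin with [w_1]. The non-empty remainder will have
    positive off-diagonal entries in its matrix. *)
Lemma fibonacci_word_prefix : (forall i, (1 <= i)%N -> w i <> [::]) ->
  forall i m, (2 <= i)%N -> exists r, w (i + m.+1)%N = w i ++ r /\ r <> [::].
Proof.
move=> w0 i m i2; elim: m => [|m [r [IH r0]]].
  exists (w i.-1); case: i i2 => [|[|i]] // _.
  by rewrite addn1 fw //; split=> //; apply: w0.
exists (r ++ w (i + m)%N); split; last by case: (r) r0.
by rewrite !addnS fw -?addnS ?IH ?catA // ltn_addr // ltnW.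
Qed.

Lemma fibonacci_word_size : (forall i, (1 <= i)%N -> w i <> [::]) ->
  forall n, (n < size (w n.+2))%N.
Proof.
move=> w0; have sz i : (1 <= i)%N -> (0 < size (w i))%N by move=> /w0; case: (w i).
elim=> [|n IH]; first exact: sz.
by rewrite fw // size_cat; have := sz n.+1 isT; lia.
Qed.
End FibonacciWords.

(** * Norms of the matrices of words *)

Section WordNorm.
Variable R : realType.

Lemma normZ_word w : w <> [::] -> normZ R (word_mx w) = (word_mx w 1 1)%:~R.
Proof.
move=> w0; have [[h1 h2 h3 h4 h5] [h6 h7 h8]] := word_mx_entries w0.
have d0 : 0 <= ((word_mx w 1 1)%:~R : R) by rewrite ler0z; lia.
apply/eqP; rewrite eq_le; apply/andP; split; last first.
  by apply: le_trans (normZ_ge R _ 1 1); rewrite ler_norm.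
apply: normZ_le => // i j.
by case: (ord2P i) (ord2P j) => -> [] ->; rewrite -intr_norm ler_int; lia.
Qed.

Lemma normZ_word_cat w1 w2 : w1 <> [::] -> w2 <> [::] ->
  normZ R (word_mx w1) * normZ R (word_mx w2) <= normZ R (word_mx (w1 ++ w2)).
Proof.
move=> n1 n2; have n12 : w1 ++ w2 <> [::] by case: (w1) n1.
rewrite !normZ_word // -intrM ler_int word_mx_cat mulmx2E.
have [_ [_ c1 _]] := word_mx_entries n1; have [_ [b2 _ _]] := word_mx_entries n2.
by rewrite lerDr mulr_ge0 // (le_trans ler01).
Qed.

Lemma nrow_carriesM (A M : 'M[int]_2) (x z mu : R) : carries A x z mu ->
  nrow x (A *m M) = `|mu| * nrow z M.
Proof.
move=> [e1 e2].
have eA j : x * ((A *m M) 0 j)%:~R - ((A *m M) 1 j)%:~R = mu * (z * (M 0 j)%:~R - (M 1 j)%:~R).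
  rewrite !mulmx2E !intrD !intrM.
  transitivity ((x * (A 0 0)%:~R - (A 1 0)%:~R) * (M 0 j)%:~R +
    (x * (A 0 1)%:~R - (A 1 1)%:~R) * (M 1 j)%:~R); first by ring.
  by rewrite e1 e2; ring.
have [mu0|mu0] := eqVneq mu 0.
  rewrite mu0 normr0 mul0r; apply/eqP; rewrite eq_le nrow_ge0 andbT.
  by apply: nrow_le => // j; rewrite eA mu0 mul0r normr0.
have mup : 0 < `|mu| by rewrite normr_gt0.
apply/eqP; rewrite eq_le; apply/andP; split.
  apply: nrow_le => [|j]; first by rewrite mulr_ge0 ?nrow_ge0.
  by rewrite eA normrM ler_wpM2l ?nrow_ge.
rewrite mulrC -ler_pdivlMr //; apply: nrow_le => [|j]; first by rewrite divr_ge0 ?nrow_ge0.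
by rewrite ler_pdivlMr // mulrC -normrM -eA nrow_ge.
Qed.

(** Let [[a b; c d]] be the matrix of [w] and [x] the value of [act w z]. The row has norm at most
    [|mu| z], the determinant gives [|mu| (b z + a) = 1], and [d = x b + mu <= (x + 1) b]. For fixed
    [x] the bound is independent of [w]. *)
Lemma nrow_act w (z : R) : w <> [::] -> 1 <= z ->
  nrow (act w z) (word_mx w) * normZ R (word_mx w) <= act w z + 1.
Proof.
move=> w0 z1; have z0 : 0 < z by apply: lt_le_trans z1.
have x0 := act_gt0 w z0; have [mu mu0 [e1 e2]] := carries_act w z0.
rewrite normZ_word //.
have [[h1 h2 h3 h4 h5] [h6 h7 h8]] := word_mx_entries w0.
have dM : ((\det (word_mx w))%:~R : R) = 1 \/ ((\det (word_mx w))%:~R : R) = -1.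
  by case/unimodularP: (word_mx_unit w) => ->; [left | right].
move: dM; rewrite det2E intrB !intrM.
have b1 : 1 <= ((word_mx w 0 1)%:~R : R) by rewrite ler1z.
have a0 : 0 <= ((word_mx w 0 0)%:~R : R) by rewrite ler0z.
have d0 : 0 <= ((word_mx w 1 1)%:~R : R) by rewrite ler0z; lia.
have rowE j : `|act w z * (word_mx w 0 j)%:~R - (word_mx w 1 j)%:~R| <= `|mu| * z.
  by case: (ord2P j) => ->; rewrite ?e1 ?e2 ?normrM ?normrN ?(gtr0_norm z0) // ler_peMr.
have zmu0 : 0 <= `|mu| * z by rewrite mulr_ge0 // ltW.
have := nrow_le zmu0 rowE; move: (nrow _ _) (nrow_ge0 (act w z) (word_mx w)) => r r0.
move: (act w z) x0 e1 e2 => x x0; clear rowE h1 h2 h3 h4 h5 h6 h7 h8.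
move: (word_mx w 0 0)%:~R (word_mx w 0 1)%:~R (word_mx w 1 0)%:~R (word_mx w 1 1)%:~R a0 b1 d0.
move=> a b c d a0 b1 d0 e1 e2 rm dM.
have m1 : `|mu| * (b * z + a) = 1.
  have p0 : 0 <= b * z + a by nra.
  rewrite -(ger0_norm p0) -normrM.
  have -> : mu * (b * z + a) = a * d - b * c.
    transitivity (b * (mu * z) - a * (- mu)); first by ring.
    by rewrite -e1 -e2; ring.
  by case: dM => ->; rewrite ?normrN normr1.
have n0 := normr_ge0 mu.
have m2 : `|mu| * z * b <= 1 by nra.
have m3 : `|mu| <= 1 by nra.
have dE : d = x * b + mu by rewrite -[mu]opprK -e2; ring.
have dle : d <= (x + 1) * b by rewrite dE; have := ler_norm mu; nra.
have : r * d <= (`|mu| * z) * d by rewrite ler_wpM2r.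
have : (`|mu| * z) * d <= (`|mu| * z) * ((x + 1) * b) by rewrite ler_wpM2l.
have : (`|mu| * z) * ((x + 1) * b) <= x + 1.
  by rewrite mulrCA ler_piMr //; nra.
by lra.
Qed.
End WordNorm.

(** * From words to matrices *)

Section Conjugation.
Variable R : realType.

Definition conj_mx (A M : 'M[int]_2) : 'M[int]_2 := A *m M *m invmx A.

Lemma conj_mxM A M N : A \in unitmx -> conj_mx A (M *m N) = conj_mx A M *m conj_mx A N.
Proof. by move=> uA; rewrite /conj_mx !mulmxA mulmxKV. Qed.

Lemma conj_mx_unit A M : A \in unitmx -> M \in unitmx -> conj_mx A M \in unitmx.
Proof. by move=> uA uM; rewrite !unitmx_mul uA uM unitmx_inv uA. Qed.

Lemma conj_mxB A M N : conj_mx A (M - N) = conj_mx A M - conj_mx A N.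
Proof. by rewrite /conj_mx mulmxBr mulmxBl. Qed.

Lemma det_conj_mx A M : A \in unitmx -> \det (conj_mx A M) = \det M.
Proof. by move=> uA; rewrite !det_mulmx mulrAC -det_mulmx mulmxV // det1 mul1r. Qed.

Lemma tr_conj_mx A M : A \in unitmx -> \tr (conj_mx A M) = \tr M.
Proof. by move=> uA; rewrite mxtrace_mulC mulKmx. Qed.

Lemma conj_mxK A M : A \in unitmx -> conj_mx (invmx A) (conj_mx A M) = M.
Proof. by move=> uA; rewrite /conj_mx invmxK !mulmxA mulVmx // mul1mx mulmxKV. Qed.

Lemma normZ_conj_mx A M : A \in unitmx ->
  normZ R (conj_mx A M) <= 4 * normZ R A ^+ 2 * normZ R M.
Proof.
move=> uA; apply: le_trans (normZM _ _ _) _; rewrite normZ_invmx //.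
have := normZM R A M; have := normZ_ge0 R A.
move: (normZ R A) (normZ R M) (normZ R (A *m M)) => a m n a0 h.
have := ler_wpM2r a0 h; lra.
Qed.
End Conjugation.

Lemma mxtrace2 (M : 'M[int]_2) : \tr M = M 0 0 + M 1 1.
Proof. by rewrite /mxtrace big_ord_recl big_ord1; congr (_ + M _ _); apply: val_inj. Qed.

Lemma associated_of_words (R : realType) (xi : R) (w : nat -> seq posnat) (u : nat -> option
  posnat) :
  fibonacci_seq cat w -> w 1%N ++ w 2%N <> w 2%N ++ w 1%N ->
  limit_word w u -> cf_coincides_up_to_first_terms xi u ->
  exists W : nat -> 'M[int]_2,
    [/\ fibonacci_seq mulmx W, forall i, (1 <= i)%N -> W i \in unitmx & associated xi W].
Proof.
move=> fw nc lim [k pq].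
have w10 : w 1%N <> [::] by move=> e; apply: nc; rewrite e cats0.
have w20 : w 2%N <> [::] by move=> e; apply: nc; rewrite e cats0.
have w0 := fibonacci_word_neq0 fw w10 w20.
have sz := fibonacci_word_size fw w0.
have uE i n : (2 <= i)%N -> (n < size (w i))%N -> u n = onth (w i) n.
  move=> i2 n_lt; case Eo: (onth (w i) n) => [a|]; first by apply/lim; exists i.
  by have := onthTE (w i) n; rewrite Eo n_lt.
have uT n : exists a, u n = Some a.
  have := uE _ _ (isT : (2 <= n.+2)%N) (sz n).
  by have := onthTE (w n.+2) n; rewrite sz; case: onth => // a _ ->; exists a.
have cqT n : exists z, complete_quotient xi (k + n) = Some z /\ 1 <= z.
  have [a ua] := uT n; have := pq n; rewrite ua /partial_quotient.
  case: complete_quotient => //= z [fz]; exists z; split=> //.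
  by have : 1 <= Num.floor z by [rewrite fz; exact: valP]; rewrite floor_ge_int.
have [v [cqv _]] := cqT 0%N; rewrite addn0 in cqv.
have [A [mu0 [uA mu00 cA]]] := complete_quotient_carries cqv.
(* From index 2 on, each word is a prefix of the limit, so it spells the first partial quotients of
   the complete quotient [v]. *)
have vE i : (2 <= i)%N -> exists2 z, 1 <= z & v = act (w i) z.
  move=> i2; have [z [cz z1]] := cqT (size (w i)); exists z => //.
  rewrite complete_quotientD cqv in cz.
  apply: act_of_quotients cz _ => n n_lt.
  by rewrite -(partial_quotientD _ cqv) pq (uE i).
have v0 : 0 < v.
  by have [z z1 ->] := vE 2%N isT; rewrite act_gt0 // (lt_le_trans ltr01).
pose W i := conj_mx A (word_mx (w i)).
have uW i : (1 <= i)%N -> W i \in unitmx by rewrite conj_mx_unit ?word_mx_unit.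
have fW : fibonacci_seq mulmx W by move=> i i1; rewrite /W fw // word_mx_cat conj_mxM.
exists W; split=> //.
pose d i := normZ R (word_mx (w i)).
pose X i := normZ R (W i).
have [K K1 [XK dK]] : exists2 K : R, 1 <= K &
    (forall i, X i <= K * d i) /\ (forall i, d i <= K * X i).
  have a1 := normZ_unimodular_ge1 R uA.
  exists (4 * normZ R A ^+ 2); first by nra.
  split=> i; first exact: normZ_conj_mx.
  rewrite /d -(conj_mxK (word_mx (w i)) uA) -/(W i).
  by apply: le_trans (normZ_conj_mx _ _ _) _; rewrite ?unitmx_inv ?normZ_invmx.
have K0 : 0 < K by apply: lt_le_trans K1.
have X1 i : (1 <= i)%N -> 1 <= X i by move=> i1; apply: normZ_unimodular_ge1; apply: uW.
have X0 i : (1 <= i)%N -> 0 < X i by move=> /X1; apply: lt_le_trans.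
have d0 i : 0 <= d i by apply: normZ_ge0.
have dM i : (1 <= i)%N -> d i.+1 * d i <= d i.+2.
  by move=> i1; rewrite /d fw //; apply: normZ_word_cat; apply: w0.
(* The factor 2 is that of the norm of a product; [K ^+ 3] comes from three exchanges between [X]
   and [d]. *)
have growth : asymp (fun i => X i.+1) (fun i => X i `^ golden R).
  apply: (@fibonacci_growth R X (2 * K ^+ 3)) => //.
  - by rewrite -[leLHS]mulr1 ler_pM ?ler1n ?exprn_ege1.
  - move=> i i1; have [h1 h2 h3 h4] := And4 (XK i) (XK i.+1) (dM i i1) (dK i.+2).
    have [x0 x1 x2] := And3 (X0 i i1) (X0 i.+1 isT) (X0 i.+2 isT).
    apply: (@le_trans _ _ (K * d i.+1 * (K * d i))).
      by apply: ler_pM => //; apply: ltW.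
    have -> : K * d i.+1 * (K * d i) = K ^+ 2 * (d i.+1 * d i) by ring.
    have kk : 0 <= K ^+ 2 by rewrite exprn_ge0 // ltW.
    apply: (le_trans (ler_wpM2l kk h3)).
    apply: (le_trans (ler_wpM2l kk h4)).
    have -> : K ^+ 2 * (K * X i.+2) = K ^+ 3 * X i.+2 by ring.
    rewrite ler_pM2r // ler_peMl ?ler1n // exprn_ge0 // ltW //.
  - move=> i i1; rewrite {1}/X fW //.
    apply: (le_trans (normZM _ _ _)); rewrite -mulrA -/(X i.+1) -/(X i).
    apply: ler_wpM2r; first by rewrite mulr_ge0 // ltW // X0.
    by rewrite ler_peMr // exprn_ege1.
split.
- move=> B.
  have dn n : n%:R <= d n.+2.
    rewrite /d normZ_word; last exact: w0.
    rewrite pmulrn ler_int; elim: n => [|n IH].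
      by have [_ [_ _ h]] := word_mx_entries w20; lia.
    rewrite fw // word_mx_cat mulmx2E.
    have [[_ _ _ _ _] [_ h1 h2]] := word_mx_entries (w0 n.+2 isT).
    have [[_ _ _ _ _] [h3 _ h4]] := word_mx_entries (w0 n.+1 isT).
    move: IH h1 h2 h3 h4; move: (word_mx _ 1 0) (word_mx _ 1 1) (word_mx _ 0 1) (word_mx _ 1 1)
      => p q r s.
    nia.
  have [n hn] : exists n : nat, K * `|B| < n%:R.
    exists (Num.truncn (K * `|B|)).+1; exact: truncnS_gt.
  exists n.+2 => //; apply: le_lt_trans (ler_norm _) _.
  by rewrite -(ltr_pM2l K0) (lt_le_trans hn) // (le_trans (dn n)).
- apply: admissible_of_commutator => //.
    rewrite /W -!conj_mxM // -conj_mxB det_conj_mx //.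
    apply: det_commutator_neq0; first exact: word_mx_trace.
    by rewrite -!word_mx_cat => /word_mx_inj.
  rewrite /W -conj_mxM // tr_conj_mx // -word_mx_cat mxtrace2.
  have w210 : w 2%N ++ w 1%N <> [::] by case: (w 2%N) w20.
  by case: (word_mx_trace w210) => -[_]; lia.
- exact: growth.
- have X10 := X0 1%N isT.
  pose C := 2 * normZ R A * `|mu0| * (v + 1) * K.
  have C0 : 0 <= C.
    by rewrite /C !mulr_ge0 ?normZ_ge0 ?addr_ge0 ?(ltW v0) ?(ltW K0).
  (* [C] works for [i >= 2], where [w_i] is a prefix of the expansion of [v]; the second term covers
     [i = 1]. *)
  exists 2^-1, (C + nrow xi (W 1%N) * X 1%N + 1); split=> //.
    by rewrite ltr_wpDl // addr_ge0 // mulr_ge0 ?nrow_ge0 // ltW.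
  move=> i i1; have x0 := X0 i i1; rewrite -/(X i) -/(nrow xi (W i)); split.
    rewrite ler_pdivrMr //; have := nrow_lower xi (uW i i1); rewrite -/(X i).
    by lra.
  rewrite ler_pdivlMr //.
  case: i i1 x0 => [//|[|i]] _ x0.
    by have := nrow_ge0 xi (W 1%N); lra.
  apply: (@le_trans _ _ C); last first.
    by rewrite -addrA lerDl addr_ge0 // mulr_ge0 ?nrow_ge0 // ltW.
  have [z z1 ev] := vE i.+2 isT.
  have h1 := nrow_act (w0 i.+2 isT) z1; rewrite -ev -/(d i.+2) in h1.
  have h2 := nrow_carriesM (word_mx (w i.+2)) cA.
  have h3 := nrowM xi (A *m word_mx (w i.+2)) (invmx A).
  rewrite normZ_invmx // -/(conj_mx _ _) -/(W _) in h3.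
  have h4 := XK i.+2.
  have [n1 n2 n3] := And3 (nrow_ge0 xi (W i.+2)) (nrow_ge0 v (word_mx (w i.+2))) (nrow_ge0 xi
    (A *m word_mx (w i.+2))).
  have a0 := normZ_ge0 R A; have m0 := normr_ge0 mu0.
  apply: (@le_trans _ _ (2 * (`|mu0| * nrow v (word_mx (w i.+2))) * normZ R A * (K * d i.+2))).
    apply: ler_pM => //; first exact: ltW.
    by apply: (le_trans h3); rewrite h2.
  have -> : 2 * (`|mu0| * nrow v (word_mx (w i.+2))) * normZ R A * (K * d i.+2) =
    2 * normZ R A * `|mu0| * K * (nrow v (word_mx (w i.+2)) * d i.+2) by ring.
  have -> : C = 2 * normZ R A * `|mu0| * K * (v + 1) by rewrite /C; ring.
  by apply: ler_wpM2l => //; rewrite !mulr_ge0 // ltW.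
- exists 1, 1; split=> // i i1; rewrite mulr1.
  by case/unimodularP: (uW i i1) => ->; rewrite ?intrN ?normrN normr1.
Qed.

(** * From matrices to words *)

(** The rows and columns of [V] nearly have ratios [rho] and [z], both above 1. If the entries are
    large, these ratios dominate the errors and, up to sign, the entries are positive and
    increasing. *)
Lemma word_of_large_mx (R : realType) (z rho : R) : 1 < z -> 1 < rho ->
  exists B : R, forall V : 'M[int]_2, V \in unitmx -> B < normZ R V ->
    nrow z V <= 1 ->
    (forall i, `|(V i 1)%:~R - rho * (V i 0)%:~R : R| <= 1) ->
    exists w s, [/\ w <> [::], s = 1 \/ s = -1 & V = s *: word_mx w].
Proof.
move=> z1 rho1.
pose t := Num.max (z - 1)^-1 (rho - 1)^-1.
have t0 : 0 <= t by rewrite le_max invr_ge0 subr_ge0 ltW.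
have tz x : t < x -> 1 < (z - 1) * x.
  rewrite gt_max => /andP[h _]; rewrite mulrC -ltr_pdivrMr ?subr_gt0 // mul1r //.
have tr x : t < x -> 1 < (rho - 1) * x.
  rewrite gt_max => /andP[_ h]; rewrite mulrC -ltr_pdivrMr ?subr_gt0 // mul1r //.
(* If the top left entry had absolute value at most [t], the four summands would bound the four
   entries. *)
exists (t + (rho * t + 1) + (z * t + 1) + (rho * (z * t + 1) + 1)) => V uV big nV rV.
have large : t < `|(V 0 0)%:~R : R|.
  rewrite ltNge; apply/negP => small; move: big; apply/negP; rewrite -leNgt.
  have := rV 0; have := rV 1; have := nrow_ge z V 0.
  have zt0 : 0 <= z * t by rewrite mulr_ge0 // ltW // (lt_trans ltr01).
  have rt0 : 0 <= rho * t by rewrite mulr_ge0 // ltW // (lt_trans ltr01).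
  have rzt0 : 0 <= rho * (z * t + 1) by rewrite mulr_ge0 ?addr_ge0 // ltW // (lt_trans ltr01).
  move=> h1 h2 h3; have {}h1 := le_trans h1 nV.
  have bnd (y r x c : R) : 1 < r -> `|x| <= c -> `|y - r * x| <= 1 -> `|y| <= r * c + 1.
    move=> r1 hx hy; have -> : y = r * x + (y - r * x) by ring.
    apply: le_trans (ler_normD _ _) _; apply: lerD => //.
    by rewrite normrM gtr0_norm ?(lt_trans ltr01) // ler_pM2l // (lt_trans ltr01).
  have b01 := bnd _ _ _ _ rho1 small h3.
  rewrite distrC in h1; have b10 := bnd _ _ _ _ z1 small h1.
  have b11 := bnd _ _ _ _ rho1 b10 h2.
  apply: normZ_le => [|i j]; first by rewrite !addr_ge0.
  by case: (ord2P i) (ord2P j) => -> [] ->; lra.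
have [s s1 sV] : exists2 s : int, s = 1 \/ s = -1 & t < (s * V 0 0)%:~R.
  have [h|h] := leP 0 ((V 0 0)%:~R : R).
    by exists 1; [left | rewrite mul1r -(ger0_norm h)].
  by exists (-1); [right | rewrite mulN1r intrN -(ltr0_norm h)].
have ss : s * s = 1 by case: s1 => ->.
pose V' := s *: V.
have V'E i j : V' i j = s * V i j by rewrite mxE.
have ns (x : R) : `|s%:~R * x| = `|x| by rewrite normrM; case: s1 => ->;
  rewrite ?intrN ?normrN normr1 mul1r.
have uV' : V' \in unitmx.
  apply/unimodularP; rewrite detZ expr2 ss mul1r; exact/unimodularP.
have r' i : `|(V' i 1)%:~R - rho * (V' i 0)%:~R : R| <= 1.
  have -> : (V' i 1)%:~R - rho * (V' i 0)%:~R = s%:~R * ((V i 1)%:~R - rho * (V i 0)%:~R).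
    by rewrite !V'E !intrM; ring.
  by rewrite ns.
have z' j : `|z * (V' 0 j)%:~R - (V' 1 j)%:~R : R| <= 1.
  have -> : z * (V' 0 j)%:~R - (V' 1 j)%:~R = s%:~R * (z * (V 0 j)%:~R - (V 1 j)%:~R).
    by rewrite !V'E !intrM; ring.
  by rewrite ns; apply: le_trans (nrow_ge _ _ _) nV.
have v00 : t < (V' 0 0)%:~R by rewrite V'E.
have v01 : ((V' 0 0)%:~R : R) < (V' 0 1)%:~R.
  by have := tr _ v00; have := r' 0; rewrite ler_norml => /andP[]; lra.
have v10 : ((V' 0 0)%:~R : R) < (V' 1 0)%:~R.
  by have := tz _ v00; have := z' 0; rewrite ler_norml => /andP[]; lra.
have v11 : ((V' 1 0)%:~R : R) < (V' 1 1)%:~R.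
  by have := tr _ (lt_trans v00 v10); have := r' 1; rewrite ler_norml => /andP[]; lra.
have v11' : ((V' 0 1)%:~R : R) < (V' 1 1)%:~R.
  by have := tz _ (lt_trans v00 v01); have := z' 1; rewrite ler_norml => /andP[]; lra.
have v0 := le_lt_trans t0 v00.
rewrite ltr0z in v0; rewrite !ltr_int in v01 v10 v11 v11'.
have [w [ew w0]] := word_mx_surj uV' (ltW v0) (ltW v01) (ltW v10) (ltW v11') (ltW v11)
  (lt_trans v0 (lt_trans v01 v11')).
exists w, s; split=> //.
by rewrite -ew scalerA ss scale1r.
Qed.

(** As [W T] is symmetric, [W T] nearly annihilates the column [(xi, -1)], so [V = A^-1 W A] nearly
    annihilates [c = A^-1 T (xi, -1)]. Up to the sign of [det A], [c] is [(E, -F)], so the rows of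
    [V] have ratio close to [E / F]. *)
Lemma eventually_word (R : realType) (xi z mu : R) (A T : 'M[int]_2)
    (n1 := xi * (T 0 0)%:~R - (T 0 1)%:~R) (n2 := xi * (T 1 0)%:~R - (T 1 1)%:~R)
    (E := (A 1 1)%:~R * n1 - (A 0 1)%:~R * n2) (F := (A 1 0)%:~R * n1 - (A 0 0)%:~R * n2) :
  A \in unitmx -> mu != 0 -> carries A xi z mu -> 1 < z -> F != 0 -> 1 < E / F ->
  exists B e : R, 0 < e /\ forall W : 'M[int]_2, W \in unitmx -> symmetric_mx (W *m T) ->
    B < normZ R W -> nrow xi W <= e ->
    exists w s, [/\ w <> [::], s = 1 \/ s = -1 & conj_mx (invmx A) W = s *: word_mx w].
Proof.
move=> uA mu0 cA z1 F0 EF.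
have [B0 hB0] := word_of_large_mx z1 EF.
have a1 := normZ_unimodular_ge1 R uA.
have a0 : 0 < normZ R A by apply: lt_le_trans a1.
have t0 := normZ_ge0 R T.
have mup : 0 < `|mu| by rewrite normr_gt0.
have Fp : 0 < `|F| by rewrite normr_gt0.
have K0 : 0 < 4 * normZ R A ^+ 2 by rewrite mulr_gt0 // exprn_gt0.
(* The first bound controls the columns of [V], the second one its rows. *)
pose e := Num.min (`|mu| / (2 * normZ R A)) (`|F| / (4 * normZ R A * (normZ R T + 1))).
have e0 : 0 < e by rewrite lt_min !divr_gt0 // ?mulr_gt0 // ltr_wpDl.
exists (4 * normZ R A ^+ 2 * B0), e; split=> // W uW sWT bigW smallW.
set V := conj_mx (invmx A) W.
have uV : V \in unitmx by rewrite conj_mx_unit ?unitmx_inv.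
have WE : W = conj_mx A V by rewrite -[in LHS](conj_mxK W (A := invmx A)) ?unitmx_inv // invmxK.
have AV : A *m V = W *m A by rewrite /V /conj_mx invmxK !mulmxA mulmxV // mul1mx.
apply: hB0 => //.
- rewrite -(ltr_pM2l K0); apply: (lt_le_trans bigW).
  by rewrite [in leLHS]WE normZ_conj_mx.
- rewrite -(ler_pM2l mup) mulr1 -(nrow_carriesM _ cA) AV.
  apply: le_trans (nrowM _ _ _) _.
  have : nrow xi W <= `|mu| / (2 * normZ R A) by apply: (le_trans smallW); rewrite ge_min lexx.
  by rewrite ler_pdivlMr ?mulr_gt0 //; lra.
- pose c : 'cV[R]_2 := map_mx intr (invmx A) *m (map_mx intr T *m (xi_row xi)^T).
  have cE : map_mx intr A *m c = map_mx intr T *m (xi_row xi)^T.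
    by rewrite mulmxA -map_mxM mulmxV // map_mx1 mul1mx.
  have Ac (i : 'I_2) : (A i 0)%:~R * c 0 0 + (A i 1)%:~R * c 1 0 = xi * (T i 0)%:~R - (T i 1)%:~R.
    have := congr1 (fun P : 'cV[R]_2 => P i 0) cE.
    by rewrite !mulmx2E !mxE /= => ->; ring.
  have Vc : map_mx intr V *m c =
      map_mx intr (invmx A) *m (xi_row xi *m map_mx intr (W *m T))^T.
    rewrite /c /V /conj_mx invmxK.
    have -> : (xi_row xi *m map_mx intr (W *m T))^T = map_mx intr (W *m T) *m (xi_row xi)^T.
      by rewrite trmx_mul map_trmx sWT.
    by rewrite !mulmxA -!map_mxM /= !mulmxA mulmxK.
  pose D : R := (\det A)%:~R.
  have D1 : `|D| = 1 by rewrite /D; case/unimodularP: uA => ->; rewrite ?intrN ?normrN normr1.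
  have DE : D = (A 0 0)%:~R * (A 1 1)%:~R - (A 0 1)%:~R * (A 1 0)%:~R.
    by rewrite /D det2E intrB !intrM.
  have eE : c 0 0 * D = E.
    rewrite /E /n1 /n2 -!Ac DE; ring.
  have fE : c 1 0 * D = - F.
    rewrite /F /n1 /n2 -!Ac DE; ring.
  move=> i.
  have := congr1 (fun P : 'cV[R]_2 => P i 0) Vc.
  rewrite mulmx2E ![map_mx _ V _ _]mxE.
  move=> eqi.
  have s1 : `|(V i 1)%:~R * F - E * (V i 0)%:~R| <= `|F|.
    have -> : (V i 1)%:~R * F - E * (V i 0)%:~R = - D * ((V i 0)%:~R * c 0 0 + (V i 1)%:~R * c
      1 0).
      by rewrite -eE -[F]opprK -fE; ring.
    rewrite eqi normrM normrN D1 mul1r mulmx2E ![(_^T)%R _ _]mxE.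
    apply: le_trans (ler_normD _ _) _; rewrite !normrM.
    have nW : nrow xi (W *m T) <= 2 * nrow xi W * normZ R T by apply: nrowM.
    have h : nrow xi W * (4 * normZ R A * (normZ R T + 1)) <= `|F|.
      rewrite -ler_pdivlMr ?mulr_gt0 // ?ltr_wpDl //.
      by apply: (le_trans smallW); rewrite ge_min lexx orbT.
    apply: (@le_trans _ _ (normZ R A * nrow xi (W *m T) + normZ R A * nrow xi (W *m T))).
      apply: lerD; apply: ler_pM => //; rewrite ?xi_rowE ?nrow_ge //.
        by rewrite -(normZ_invmx R uA) mxE normZ_ge.
      by rewrite -(normZ_invmx R uA) mxE normZ_ge.
    have := nrow_ge0 xi W; have := nrow_ge0 xi (W *m T).
    move: (nrow xi W) (nrow xi (W *m T)) nW h => p q nW h q0 p0.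
    have : normZ R A * q <= normZ R A * (2 * p * normZ R T) by rewrite ler_wpM2l // ltW.
    have : 0 <= normZ R A * p by rewrite mulr_ge0 // ltW.
    lra.
  rewrite -(ler_pM2r Fp) mul1r -normrM.
  have -> : ((V i 1)%:~R - E / F * (V i 0)%:~R) * F = (V i 1)%:~R * F - E * (V i 0)%:~R.
    by field.
  exact: s1.
Qed.

(** [F] and [E - F] are [th] times [A 0 0] and [A 0 1 - A 0 0], both at least [m], up to errors of
    at most [2 |n1|]. Hence both have the sign of [th]. *)
Lemma convergent_ratio (R : realType) (xi n1 n2 : R) k (A : 'M[int]_2) (z mu : R) (m : nat)
    (E := (A 1 1)%:~R * n1 - (A 0 1)%:~R * n2) (F := (A 1 0)%:~R * n1 - (A 0 0)%:~R * n2) :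
  convergent xi k A z mu -> m%:Z <= A 0 0 -> A 0 0 + m%:Z <= A 0 1 ->
  2 * `|n1| < m%:R * `|xi * n1 - n2| -> F != 0 /\ 1 < E / F.
Proof.
move=> [[_ _ _ [e1 e2] _] [_ _ _ m1 m2]] am bm.
set th := xi * n1 - n2 => big.
have FE : F = (A 0 0)%:~R * th - mu * z * n1 by rewrite /F /th -e1; ring.
have EE : E = (A 0 1)%:~R * th + mu * n1 by rewrite /E /th -[mu]opprK -e2; ring.
have a_m : m%:R <= (A 0 0)%:~R :> R by rewrite pmulrn ler_int.
have b_m : m%:R <= (A 0 1)%:~R - (A 0 0)%:~R :> R.
  by rewrite -intrB pmulrn ler_int lerBrDr addrC.
have n0 := normr_ge0 n1; have t0 := normr_ge0 th.
have small (x c : R) : `|x| <= 2 -> m%:R <= c -> 0 < th * (c * th + x * n1).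
  move=> x2 mc.
  have : `|x * n1| <= 2 * `|n1| by rewrite normrM ler_wpM2r.
  rewrite ler_norml => /andP[l1 l2].
  have ct : m%:R * `|th| <= c * `|th| by rewrite ler_wpM2r.
  have : th != 0 by apply: contraTneq big => ->; rewrite normr0 mulr0 -leNgt mulr_ge0.
  rewrite neq_lt => /orP[h|h]; move: ct big.
    by rewrite (ltr0_norm h) => ct big; rewrite nmulr_rgt0 //; lra.
  by rewrite (gtr0_norm h) => ct big; rewrite mulr_gt0 //; lra.
have F1 : 0 < th * F.
  rewrite FE -mulNr; apply: small => //; rewrite normrN; lra.
have F0 : F != 0 by apply: contraTneq F1 => ->; rewrite mulr0 ltxx.
have th0 : th != 0 by apply: contraTneq F1 => ->; rewrite mul0r ltxx.
split=> //.
have D1 : 0 < th * (E - F).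
  have -> : E - F = ((A 0 1)%:~R - (A 0 0)%:~R) * th + (mu + mu * z) * n1.
    by rewrite EE FE; ring.
  by apply: small => //; apply: le_trans (ler_normD _ _) _; lra.
rewrite -subr_gt0.
have -> : E / F - 1 = (th * (E - F)) / (th * F) by field; rewrite F0 th0.
exact: divr_gt0.
Qed.

(** Its vanishing would be a quadratic relation for [xi], with all coefficients 0 only if [N] is
    skew-symmetric. *)
Lemma twist_form_neq0 (R : realType) (xi : R) (N : 'M[int]_2) :
  ~ integer_quadratic_root xi -> ~ skew_symmetric_mx N ->
  xi * (xi * (N 0 0)%:~R - (N 0 1)%:~R) - (xi * (N 1 0)%:~R - (N 1 1)%:~R) != 0.
Proof.
move=> nalg nskew; apply/eqP => e; apply: nalg.
exists (N 0 0), (- (N 0 1 + N 1 0)), (N 1 1); split.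
  move=> [h0 h1 h2]; apply: nskew; rewrite /skew_symmetric_mx [N]mx2_eta !mx2E h0 h2.
  by congr mx2; lia.
by rewrite intrN intrD -e; ring.
Qed.

Section FromAssociated.
Variables (R : realType) (xi : R) (W : nat -> 'M[int]_2).
Hypothesis xi_alg : ~ integer_quadratic_root xi.
Hypothesis fW : fibonacci_seq mulmx W.
Hypothesis uW : forall i, (1 <= i)%N -> W i \in unitmx.
Hypothesis aW : associated xi W.

Lemma associated_eventually_words : exists k A (z mu : R) i0,
  [/\ [/\ complete_quotient xi k = Some z, A \in unitmx, mu != 0, carries A xi z mu & 1 < z],
      (1 <= i0)%N &
      forall i, (i0 <= i)%N -> exists w s,
        [/\ w <> [::], s = 1 \/ s = -1 & conj_mx (invmx A) (W i) = s *: word_mx w]].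
Proof.
have [_ [N [_ sN kN sW]] _ _ _] := aW.
have irr : ~ Defs.rational xi by move=> h; apply: xi_alg; apply/rational_or_quadraticP; left.
pose th : R := xi * (xi * (N 0 0)%:~R - (N 0 1)%:~R) - (xi * (N 1 0)%:~R - (N 1 1)%:~R).
have th0 : 0 < `|th| by rewrite normr_gt0 twist_form_neq0.
pose n (T : 'M[int]_2) : R := xi * (T 0 0)%:~R - (T 0 1)%:~R.
(* Large enough for [N] and its transpose, which share the value [th]; one convergent matrix thus
   serves both parities of the index. *)
pose m := (Num.truncn (2 * (`|n N| + `|n N^T|) / `|th|)).+1.
have mP : 2 * (`|n N| + `|n N^T|) < m%:R * `|th| by rewrite -ltr_pdivrMr // truncnS_gt.
have [k [A [z [mu [cA am bm]]]]] := convergent_large m irr.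
have [[cq uA mu0 crA z1] _] := cA.
have [n0 nt0] := (normr_ge0 (n N), normr_ge0 (n N^T)).
have [|F1 E1] := convergent_ratio (n1 := n N) (n2 := xi * (N 1 0)%:~R - (N 1 1)%:~R) cA am bm.
  by rewrite -/th; lra.
have [|F2 E2] := convergent_ratio (n1 := n N^T) (n2 := xi * (N^T 1 0)%:~R - (N^T 1 1)%:~R) cA
  am bm.
  have -> : xi * n N^T - (xi * (N^T 1 0)%:~R - (N^T 1 1)%:~R) = th by rewrite /n /th !mxE; ring.
  by lra.
have [B1 [e1 [e10 h1]]] := eventually_word uA mu0 crA z1 F1 E1.
have [B2 [e2 [e20 h2]]] := eventually_word uA mu0 crA z1 F2 E2.
have e0 : 0 < Num.min e1 e2 by rewrite lt_min e10.
have [i1 i10 hi1] := associated_norm_diverges uW aW (Num.max B1 B2).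
have [i2 _ hi2] := associated_nrow_small uW aW e0.
exists k, A, z, mu, (maxn i1 i2); split=> //; first by rewrite leq_max i10.
move=> i; rewrite geq_max => /andP[le1 le2].
have := hi1 i le1; have := hi2 i le2; rewrite lt_min gt_max => /andP[ne1 ne2] /andP[nB1 nB2].
have i_gt0 := leq_trans i10 le1; have := sW i i_gt0.
case: odd => sWi.
  by apply: h2 => //; [apply: uW | apply: ltW].
by apply: h1 => //; [apply: uW | apply: ltW].
Qed.

Lemma words_of_associated : exists w : nat -> seq posnat,
  [/\ fibonacci_seq cat w, w 1%N ++ w 2%N <> w 2%N ++ w 1%N &
      exists2 u : nat -> option posnat, limit_word w u & cf_coincides_up_to_first_terms xi u].
Proof.
have [k [A [z [mu [i0 [[cq uA mu0 cA z1] i01 ev]]]]]] := associated_eventually_words.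
have irr : ~ Defs.rational xi by move=> h; apply: xi_alg; apply/rational_or_quadraticP; left.
have irz := carries_irrational uA mu0 cA irr.
have /choice[w hw] : forall j, exists w, w <> [::] /\ exists s,
    (s = 1 \/ s = -1) /\ conj_mx (invmx A) (W (i0 + j)) = s *: word_mx w.
  by move=> j; have [|w [s [h1 h2 h3]]] := ev (i0 + j)%N; [lia | exists w; split=> //; exists s].
have w0 j : w j <> [::] by have [] := hw j.
pose V i := conj_mx (invmx A) (W i).
(* The bottom right entry for a non-empty word is positive, so it determines the sign. *)
have sgn (s t : int) w1 w2 : w1 <> [::] -> w2 <> [::] -> (s = 1 \/ s = -1) -> (t = 1 \/ t = -1) ->
    s *: word_mx w1 = t *: word_mx w2 -> w1 = w2.
  move=> n1 n2 s1 t1 e; have := congr1 (fun M : 'M[int]_2 => M 1 1) e; rewrite !mxE.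
  have [_ [_ _ d1]] := word_mx_entries n1; have [_ [_ _ d2]] := word_mx_entries n2.
  move=> e11; have st : s = t.
    move: (word_mx w1 1 1) (word_mx w2 1 1) e11 d1 d2 => a b.
    by case: s1 t1 => -> [] -> e11 d1 d2 //; lia.
  move: e; rewrite st => e; apply: word_mx_inj.
  by case: t1 e => -> ; rewrite ?scale1r // !scaleN1r => /oppr_inj.
have fw : fibonacci_seq cat w.
  move=> j j1; have [_ [s [s1 e1]]] := hw j; have [_ [t [t1 e2]]] := hw j.+1.
  have [n3 [r [r1 e3]]] := hw j.+2.
  apply: (sgn r (t * s)) => //; first by case: (w j.+1) (w0 j.+1).
    by case: s1 t1 => -> [] ->; [left|right|right|left].
  rewrite -e3 !addnS fW; last by lia.
  rewrite conj_mxM ?unitmx_inv // -addnS e1 e2 word_mx_cat.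
  by rewrite -scalemxAl -scalemxAr scalerA.
exists w; split=> //.
  (* Commuting words would make two consecutive [W_i] commute, and [N] would be symmetric. *)
  move=> cw; have [_ [s [s1 e1]]] := hw 1%N; have [_ [t [t1 e2]]] := hw 2%N.
  have [_ [N [_ sN _ sW]] _ _ _] := aW.
  have u1 := @uW (i0 + 1)%N (leq_trans i01 (leq_addr _ _)).
  have u2 := @uW (i0 + 2)%N (leq_trans i01 (leq_addr _ _)).
  have cWW : W (i0 + 1) *m W (i0 + 2) = W (i0 + 2) *m W (i0 + 1).
    rewrite -[LHS](conj_mxK _ (A := invmx A)) ?unitmx_inv // -[RHS](conj_mxK _ (A := invmx A))
      ?unitmx_inv //.
    rewrite ![conj_mx (invmx A) (_ *m _)]conj_mxM ?unitmx_inv // e1 e2.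
    by rewrite -!scalemxAl -!scalemxAr -!word_mx_cat cw !scalerA mulrC.
  have sW1 := sW (i0 + 1)%N (leq_trans i01 (leq_addr _ _)).
  have sW2 := sW (i0 + 2)%N (leq_trans i01 (leq_addr _ _)).
  have sW3 := sW (i0 + 3)%N (leq_trans i01 (leq_addr _ _)).
  have e3 : W (i0 + 3)%N = W (i0 + 2)%N *m W (i0 + 1)%N.
    by rewrite !(addnS, addn0) fW.
  rewrite e3 in sW3.
  have := commuting_twist_symmetric (N := twist N (i0 + 1)) u1 u2 cWW sW1.
  rewrite -twistS -addnS => /(_ sW2).
  have -> : twist N (i0 + 1) = twist N (i0 + 3).
    by rewrite /twist !oddD /=; case: odd.
  move=> /(_ sW3); rewrite /twist; case: odd => // h; apply: sN.
  by move: h; rewrite /symmetric_mx trmxK.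
have small (e : R) i : 0 < e -> exists2 j, (i <= j)%N & nrow z (word_mx (w j)) < e.
  move=> e0.
  have a1 := normZ_unimodular_ge1 R uA.
  have a0 : 0 < 2 * normZ R A by rewrite mulr_gt0 // (lt_le_trans ltr01).
  have mup : 0 < `|mu| by rewrite normr_gt0.
  have [i1 _ h] := associated_nrow_small uW aW (divr_gt0 (mulr_gt0 mup e0) a0).
  exists (maxn i i1); first by rewrite leq_maxl.
  set j := maxn i i1.
  have hj := h (i0 + j)%N (leq_trans (leq_maxr i i1) (leq_addl _ _)).
  have [_ [s [s1 ew]]] := hw j.
  have -> : word_mx (w j) = s *: conj_mx (invmx A) (W (i0 + j)).
    by rewrite ew scalerA; case: s1 => ->; rewrite scale1r.
  have -> : nrow z (s *: conj_mx (invmx A) (W (i0 + j))) = nrow z (conj_mx (invmx A) (W (i0 +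
    j))).
    case: s1 => ->; rewrite ?scale1r // scaleN1r /nrow.
    by rewrite (map_mxN intr) mulmxN mx_normN.
  rewrite -(ltr_pM2l mup) -(nrow_carriesM _ cA) /conj_mx invmxK !mulmxA mulmxV // mul1mx.
  apply: le_lt_trans (nrowM _ _ _) _.
  by move: hj; rewrite ltr_pdivlMr //; lra.
have zact i : (2 <= i)%N -> exists2 zeta, 1 < zeta & z = act (w i) zeta.
  move=> i2; have [[h1 h2 h3 h4 h5] [h6 h7 h8]] := word_mx_entries (w0 i).
  pose be : R := - (z * (word_mx (w i) 0 1)%:~R - (word_mx (w i) 1 1)%:~R).
  have be0 : be != 0.
    rewrite oppr_eq0; apply/eqP => e; apply: irz.
    exists ((word_mx (w i) 1 1)%:~R / (word_mx (w i) 0 1)%:~R).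
    have nz : ((word_mx (w i) 0 1)%:~R : R) != 0 by rewrite intr_eq0; lia.
    rewrite fmorph_div /= !ratr_int; apply: (mulIf nz); rewrite divfK //.
    by apply/eqP; rewrite -subr_eq0 e.
  pose zeta : R := (z * (word_mx (w i) 0 0)%:~R - (word_mx (w i) 1 0)%:~R) / be.
  have cz : carries (word_mx (w i)) z zeta be.
    by split; [rewrite [RHS]mulrC divfK | rewrite opprK].
  have irzeta := carries_irrational (word_mx_unit _) be0 cz irz.
  (* If [zeta < 1], every longer word [w_i r] would give a row of norm at least [|be| (1 - zeta)],
     because the second column of the matrix of [r] satisfies [1 <= r01 <= r11]; this contradicts
     [small]. *)
  have zeta1 : 1 < zeta.
    rewrite lt_neqAle; apply/andP; split.
      by apply/eqP => e; apply: irzeta; exists 1; rewrite rmorph1.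
    rewrite leNgt; apply/negP => zl.
    have bep : 0 < `|be| by rewrite normr_gt0.
    have dp : 0 < `|be| * (1 - zeta) by rewrite mulr_gt0 // subr_gt0.
    have [j le_ij hj] := small _ i.+1 dp.
    have [r [er r0]] := fibonacci_word_prefix fw (fun i _ => w0 i) (j - i.+1)%N i2.
    have ej : (i + (j - i.+1).+1)%N = j by lia.
    rewrite ej in er.
    move: hj; rewrite er word_mx_cat (nrow_carriesM _ cz) ltr_pM2l //.
    apply/negP; rewrite -leNgt; apply: le_trans (nrow_ge _ _ 1).
    have [[_ _ _ k4 _] [k6 _ _]] := word_mx_entries r0.
    rewrite distrC; apply: le_trans (ler_norm _).
    have k4' : ((word_mx r 0 1)%:~R : R) <= (word_mx r 1 1)%:~R by rewrite ler_int.
    have k6' : 1 <= ((word_mx r 0 1)%:~R : R) by rewrite ler1z.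
    nra.
  exists zeta => //.
  have [nu nu0 cz'] := carries_act (w i) (lt_trans ltr01 zeta1).
  exact: carries_source_uniq (word_mx_unit _) be0 cz cz'.
have w0' i : (1 <= i)%N -> w i <> [::] by move=> _; apply: w0.
have sz := fibonacci_word_size fw w0'.
(* The word of index [n + 2] has more than [n] letters, and prefix stability makes the choice
   immaterial. *)
exists (fun n => onth (w n.+2) n).
  move=> n a; split=> [h|[i i2 h]]; first by exists n.+2.
  have n_lt : (n < size (w i))%N by rewrite -onthTE h.
  rewrite -(onth_fibonacci_prefix fw (isT : (2 <= n.+2)%N) (leq_maxl n.+2 i) (sz n)).
  by rewrite (onth_fibonacci_prefix fw i2 (leq_maxr n.+2 i) n_lt).
exists k => n; rewrite (partial_quotientD _ cq).
have [zeta zeta1 ->] := zact n.+2 isT.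
by have [_ ->] := complete_quotient_act (w n.+2) zeta1.
Qed.
End FromAssociated.

Theorem theorem2p2 (R : realType) (xi : R) :
  (extremal xi /\
   exists W : nat -> 'M[int]_2,
     [/\ fibonacci_in_P W, associated xi W &
         forall i : nat, (1 <= i)%N -> W i \in unitmx])
  <->
  (exists w : nat -> seq posnat,
     [/\ fibonacci_seq cat w,
         w 1%N ++ w 2%N <> w 2%N ++ w 1%N &
         exists2 u : nat -> option posnat,
           limit_word w u & cf_coincides_up_to_first_terms xi u]).
Proof.
split=> [[[irr nquad _] [W [[_ fW] aW uW]]]|[w [fw nc [u lim cf]]]].
  apply: (words_of_associated _ _ uW aW); first by move/rational_or_quadraticP => -[].
  by move=> i i1; rewrite fW // star_unimodular ?uW.
have [W [fW uW aW]] := associated_of_words fw nc lim cf.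
split; first exact: extremal_of_associated uW aW fW.
exists W; split=> //; split=> [i i1|i i1]; first by apply: unimodular_in_P; apply: uW.
by rewrite fW // star_unimodular ?uW.
Qed.
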